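(* Let $\mathcal{C}$ be a triangulated category that has all small coproducts and satisfies the following Brown representability property: every cohomological functor $\mathcal{C}^{op}\to \mathrm{Ab}$ that converts small coproducts in $\mathcal{C}$ into products of abelian groups is representable by an object of $\mathcal{C}$. Let $w$ be a weight structure on $\mathcal{C}$. Then there exists a $t$-structure $t$ on $\mathcal{C}$ that is right adjacent to $w$ if and only if $w$ is smashing. Moreover, if such a $t$ exists, then the heart of $t$ is equivalent to the category of all those additive functors $\underline{Hw}^{op}\to \mathrm{Ab}$ that respect products (i.e., that convert coproducts in $\underline{Hw}$ into products of abelian groups), where $\underline{Hw}$ is the heart of $w$.
   Context: Weight structures: a weight structure $w$ on a triangulated category $\mathcal{C}$ is a pair of classes $(\mathcal{C}_{w\le 0},\mathcal{C}_{w\ge 0})$ of objects of $\mathcal{C}$ such that: (i) both classes are closed under retracts in $\mathcal{C}$; (ii) $\mathcal{C}_{w\le 0}\subset \mathcal{C}_{w\le 0}[1]$ and $\mathcal{C}_{w\ge 0}[1]\subset \mathcal{C}_{w\ge 0}$; (iii) $\mathcal{C}(X,Y)=0$ for all $X\in\mathcal{C}_{w\le 0}$, $Y\in \mathcal{C}_{w\ge 0}[1]$; (iv) every object $M$ of $\mathcal{C}$ fits in a distinguished triangle $LM\to M\to RM\to LM[1]$ with $LM\in\mathcal{C}_{w\le 0}$, $RM\in \mathcal{C}_{w\ge 0}[1]$. The heart $\underline{Hw}$ is the full subcategory of $\mathcal{C}$ with object class $\mathcal{C}_{w\le 0}\cap\mathcal{C}_{w\ge 0}$. $w$ is smashing if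 $\mathcal{C}$ has coproducts and $\mathcal{C}_{w\ge 0}$ is closed under small $\mathcal{C}$-coproducts. $t$-structures $t=(\mathcal{C}^{t\le 0},\mathcal{C}^{t\ge 0})$ are in the usual cohomological convention ($\mathcal{C}^{t\le 0}[1]\subset\mathcal{C}^{t\le 0}$), with both classes closed under isomorphisms. $t$ is right adjacent to $w$ if $\mathcal{C}^{t\le 0}=\mathcal{C}_{w\ge 0}$. *)

(* Defs.v *)
From HB Require Import structures.
From mathcomp Require Import all_boot ssralg boolp.

Set Implicit Arguments.
Unset Strict Implicit.
Unset Printing Implicit Defensive.

Import GRing.Theory.
#[local] Obligation Tactic := idtac.
Local Open Scope ring_scope.

(* Sizes: homs in preadditive categories are [zmodType]s, and [small] is the
   universe of their carriers, so preadditive categories are locally small while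
   their objects, and the homs of a plain [category] such as a functor category,
   may live in a larger universe. Small coproducts are those indexed by [small]. *)
Definition small := Type@{Algebra.Zmodule.axioms_.u0}.

Record category := Category {
  obj :> Type;
  hom : obj -> obj -> Type;
  idc : forall X, hom X X;
  comp : forall X Y Z, hom Y Z -> hom X Y -> hom X Z;
  comp_idl : forall X Y (f : hom X Y), comp (idc Y) f = f;
  comp_idr : forall X Y (f : hom X Y), comp f (idc X) = f;
  comp_assoc : forall X Y Z W (h : hom Z W) (g : hom Y Z) (f : hom X Y),
    comp h (comp g f) = comp (comp h g) f
}.
Arguments hom {c} X Y.
Arguments idc {c} X.
Arguments comp {c X Y Z} g f.
Notation "g \oc f" := (comp g f) (at level 40, left associativity).

Section Category.
Variable C : category.

Definition is_iso (X Y : C) (f : hom X Y) : Prop :=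
  exists g : hom Y X, g \oc f = idc X /\ f \oc g = idc Y.

Definition isomorphic (X Y : C) : Prop := exists f : hom X Y, is_iso f.

Definition retract_of (Y X : C) : Prop :=
  exists (i : hom Y X) (p : hom X Y), p \oc i = idc Y.

Definition is_coproduct (I : small) (X : I -> C) (S : C)
    (inj : forall i, hom (X i) S) : Prop :=
  forall (Y : C) (f : forall i, hom (X i) Y),
    exists! g : hom S Y, forall i, g \oc inj i = f i.

Definition has_coproducts : Prop :=
  forall (I : small) (X : I -> C),
    exists (S : C) (inj : forall i, hom (X i) S), is_coproduct inj.

Definition closed_under_iso (P : C -> Prop) : Prop :=
  forall X Y : C, isomorphic X Y -> P X -> P Y.

Definition closed_under_retracts (P : C -> Prop) : Prop :=
  forall X Y : C, retract_of Y X -> P X -> P Y.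

Definition closed_under_coproducts (P : C -> Prop) : Prop :=
  forall (I : small) (X : I -> C) (S : C) (inj : forall i, hom (X i) S),
    is_coproduct inj -> (forall i, P (X i)) -> P S.

Definition full_subcategory (P : C -> Prop) : category :=
  @Category {X : C | P X} (fun X Y => hom (sval X) (sval Y))
    (fun X => idc (sval X)) (fun X Y Z g f => g \oc f)
    (fun X Y f => comp_idl f) (fun X Y f => comp_idr f)
    (fun X Y Z W h g f => comp_assoc h g f).

End Category.

Record functor (C D : category) := Functor {
  fobj :> C -> D;
  fmap : forall X Y : C, hom X Y -> hom (fobj X) (fobj Y);
  fmap_id : forall X : C, fmap (idc X) = idc (fobj X);
  fmap_comp : forall (X Y Z : C) (g : hom Y Z) (f : hom X Y),
    fmap (g \oc f) = fmap g \oc fmap f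
}.
Arguments fmap {C D} F {X Y} f : rename.

Definition functor_id (C : category) : functor C C :=
  @Functor C C (fun X => X) (fun X Y f => f)
    (fun X => erefl) (fun X Y Z g f => erefl).

Program Definition functor_comp (C D E : category) (G : functor D E)
    (F : functor C D) : functor C E :=
  @Functor C E (fun X => G (F X)) (fun X Y f => fmap G (fmap F f)) _ _.
Next Obligation. by move=> * /=; rewrite !fmap_id. Qed.
Next Obligation. by move=> * /=; rewrite !fmap_comp. Qed.

Record nat_trans (C D : category) (F G : functor C D) := NatTrans {
  nt :> forall X : C, hom (F X) (G X);
  nt_natural : forall (X Y : C) (f : hom X Y),
    nt Y \oc fmap F f = fmap G f \oc nt X
}.

Lemma nat_trans_eq (C D : category) (F G : functor C D) (a b : nat_trans F G) :
  (forall X, a X = b X) -> a = b.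
Proof.
case: a b => [a Ha] [b Hb] /= ab.
have e : a = b by apply: functional_extensionality_dep.
by subst b; congr NatTrans; apply: Prop_irrelevance.
Qed.

Section FunctorCategory.
Variables C D : category.

Program Definition nt_id (F : functor C D) : nat_trans F F :=
  @NatTrans C D F F (fun X => idc (F X)) _.
Next Obligation. by move=> * /=; rewrite comp_idl comp_idr. Qed.

Program Definition nt_comp (F G H : functor C D) (b : nat_trans G H)
    (a : nat_trans F G) : nat_trans F H :=
  @NatTrans C D F H (fun X => b X \oc a X) _.
Next Obligation.
by move=> F G H b a X Y f /=; rewrite -comp_assoc nt_natural !comp_assoc nt_natural.
Qed.

Program Definition functor_category : category :=
  @Category (functor C D) (@nat_trans C D) nt_id nt_comp _ _ _.
Next Obligation. by move=> *; apply: nat_trans_eq => X; exact: comp_idl. Qed.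
Next Obligation. by move=> *; apply: nat_trans_eq => X; exact: comp_idr. Qed.
Next Obligation. by move=> *; apply: nat_trans_eq => X; exact: comp_assoc. Qed.

Definition naturally_isomorphic (F G : functor C D) : Prop :=
  @isomorphic functor_category F G.

End FunctorCategory.

Definition is_equivalence (C D : category) (F : functor C D) : Prop :=
  exists G : functor D C,
    naturally_isomorphic (functor_comp G F) (functor_id C) /\
    naturally_isomorphic (functor_comp F G) (functor_id D).

Definition equivalent (C D : category) : Prop :=
  exists F : functor C D, is_equivalence F.

Record preadditive := Preadditive {
  pobj : Type;
  phom : pobj -> pobj -> zmodType;
  pid : forall X, phom X X;
  pcomp : forall X Y Z, phom Y Z -> phom X Y -> phom X Z;
  pcomp_idl : forall X Y (f : phom X Y), pcomp (pid Y) f = f;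
  pcomp_idr : forall X Y (f : phom X Y), pcomp f (pid X) = f;
  pcomp_assoc : forall X Y Z W (h : phom Z W) (g : phom Y Z) (f : phom X Y),
    pcomp h (pcomp g f) = pcomp (pcomp h g) f;
  pcompDl : forall X Y Z (g g' : phom Y Z) (f : phom X Y),
    pcomp (g + g') f = pcomp g f + pcomp g' f;
  pcompDr : forall X Y Z (g : phom Y Z) (f f' : phom X Y),
    pcomp g (f + f') = pcomp g f + pcomp g f'
}.

Definition category_of (A : preadditive) : category :=
  @Category (pobj A) (fun X Y => phom X Y) (@pid A) (@pcomp A)
    (@pcomp_idl A) (@pcomp_idr A) (@pcomp_assoc A).
Coercion category_of : preadditive >-> category.

Definition opposite (A : preadditive) : preadditive :=
  @Preadditive (pobj A) (fun X Y => phom Y X) (@pid A)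
    (fun X Y Z g f => pcomp f g)
    (fun X Y f => pcomp_idr f) (fun X Y f => pcomp_idl f)
    (fun X Y Z W h g f => esym (pcomp_assoc f g h))
    (fun X Y Z g g' f => pcompDr f g g') (fun X Y Z g f f' => pcompDl f f' g).

Definition full_subpreadditive (A : preadditive) (P : A -> Prop) : preadditive :=
  @Preadditive {X : A | P X} (fun X Y => phom (sval X) (sval Y))
    (fun X => pid (sval X)) (fun X Y Z g f => pcomp g f)
    (fun X Y f => pcomp_idl f) (fun X Y f => pcomp_idr f)
    (fun X Y Z W h g f => pcomp_assoc h g f)
    (fun X Y Z g g' f => pcompDl g g' f) (fun X Y Z g f f' => pcompDr g f f').

Definition additive_functor (A B : preadditive) (F : functor A B) : Prop :=
  forall (X Y : A) (f g : hom X Y), fmap F (f + g) = fmap F f + fmap F g.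

Definition is_zero (A : preadditive) (Z : A) : Prop :=
  forall X : A, (forall f : hom X Z, f = 0) /\ (forall f : hom Z X, f = 0).

Definition is_biproduct (A : preadditive) (X Y S : A) : Prop :=
  exists (i : hom X S) (j : hom Y S) (p : hom S X) (q : hom S Y),
    [/\ p \oc i = idc X, q \oc j = idc Y, p \oc j = 0, q \oc i = 0 &
        i \oc p + j \oc q = idc S].

Definition is_additive (A : preadditive) : Prop :=
  (exists Z : A, is_zero Z) /\ (forall X Y : A, exists S : A, is_biproduct X Y S).

Lemma additive_eq (U V : zmodType) (f g : {additive U -> V}) : f =1 g -> f = g.
Proof.
case: f => f [[f_add]]; case: g => g [[g_add]] /= fg.
have e : f = g by exact: funext.
by subst g; rewrite (Prop_irrelevance f_add g_add).
Qed.

Program Definition Ab : category :=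
  @Category zmodType (fun U V => {additive U -> V}) (fun U => idfun)
    (fun U V W g f => g \o f) _ _ _.
Next Obligation. by move=> *; apply: additive_eq. Qed.
Next Obligation. by move=> *; apply: additive_eq. Qed.
Next Obligation. by move=> *; apply: additive_eq. Qed.

Section Presheaves.
Variable A : preadditive.

Definition presheaf := functor (opposite A) Ab.

Definition sections (F : presheaf) (X : A) : zmodType := F X.

Definition pullback (F : presheaf) (X Y : A) (f : hom X Y) :
  {additive sections F Y -> sections F X} := @fmap _ _ F Y X f.

Definition additive_presheaf (F : presheaf) : Prop :=
  forall (X Y : A) (f g : hom X Y) (y : sections F Y),
    pullback F (f + g) y = pullback F f y + pullback F g y.

(* The canonical map from F(S) to the product of the F(X_i) is bijective for
   every coproduct S of a small family X_i in A. *)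
Definition respects_products (F : presheaf) : Prop :=
  forall (I : small) (X : I -> A) (S : A) (inj : forall i, hom (X i) S),
    is_coproduct inj ->
    forall y : (forall i, sections F (X i)),
      exists! s : sections F S, forall i, pullback F (inj i) s = y i.

Definition precomp (T X Y : A) (f : hom X Y) : phom Y T -> phom X T :=
  fun g => pcomp g f.

Lemma precomp_is_nmod (T X Y : A) (f : hom X Y) :
  nmod_morphism (precomp (T := T) f).
Proof.
have D : {morph precomp (T := T) f : g h / g + h} by move=> g h; exact: pcompDl.
by split=> //; apply: (addrI (precomp f 0)); rewrite -D !addr0.
Qed.

HB.instance Definition _ (T X Y : A) (f : hom X Y) :=
  GRing.isNmodMorphism.Build _ _ (precomp (T := T) f) (precomp_is_nmod T f).

Program Definition representable_presheaf (T : A) : presheaf :=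
  @Functor (opposite A) Ab (fun X : A => @phom A X T)
    (fun (Y X : A) (f : hom X Y) => precomp f) _ _.
Next Obligation. by move=> T X; apply: additive_eq => g; exact: pcomp_idr. Qed.
Next Obligation.
by move=> T X Y Z f g; apply: additive_eq => h; exact: pcomp_assoc.
Qed.

Definition representable (F : presheaf) : Prop :=
  exists T : A, naturally_isomorphic F (representable_presheaf T).

Definition product_functors : category :=
  @full_subcategory (functor_category (opposite A) Ab)
    (fun F => additive_presheaf F /\ respects_products F).

End Presheaves.

(* The suspension X |-> X[1] is an additive autoequivalence, not necessarily a
   strict automorphism. [dist f g h] says that X -f-> Y -g-> Z -h-> X[1] is a
   distinguished triangle. *)
Record triangulated := Triangulated {
  tcat :> preadditive;
  tcat_additive : is_additive tcat;
  shift : functor tcat tcat;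
  shift_additive : additive_functor shift;
  shift_equivalence : is_equivalence shift;
  dist : forall X Y Z : tcat, hom X Y -> hom Y Z -> hom Z (shift X) -> Prop;
  dist_iso : forall (X Y Z X' Y' Z' : tcat)
      (f : hom X Y) (g : hom Y Z) (h : hom Z (shift X))
      (f' : hom X' Y') (g' : hom Y' Z') (h' : hom Z' (shift X'))
      (a : hom X X') (b : hom Y Y') (c : hom Z Z'),
    is_iso a -> is_iso b -> is_iso c ->
    b \oc f = f' \oc a -> c \oc g = g' \oc b -> fmap shift a \oc h = h' \oc c ->
    dist f g h -> dist f' g' h';
  dist_id : forall X Z : tcat, is_zero Z ->
    dist (idc X) (0 : hom X Z) (0 : hom Z (shift X));
  dist_cone : forall (X Y : tcat) (f : hom X Y),
    exists (Z : tcat) (g : hom Y Z) (h : hom Z (shift X)), dist f g h;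
  dist_rotate : forall (X Y Z : tcat)
      (f : hom X Y) (g : hom Y Z) (h : hom Z (shift X)),
    dist f g h <-> dist g h (- fmap shift f);
  dist_morphism : forall (X Y Z X' Y' Z' : tcat)
      (f : hom X Y) (g : hom Y Z) (h : hom Z (shift X))
      (f' : hom X' Y') (g' : hom Y' Z') (h' : hom Z' (shift X'))
      (a : hom X X') (b : hom Y Y'),
    dist f g h -> dist f' g' h' -> b \oc f = f' \oc a ->
    exists c : hom Z Z',
      c \oc g = g' \oc b /\ fmap shift a \oc h = h' \oc c;
  dist_octahedron : forall (X Y Z U V W : tcat)
      (f : hom X Y) (a : hom Y U) (b : hom U (shift X))
      (g : hom Y Z) (c : hom Z V) (d : hom V (shift Y))
      (p : hom Z W) (q : hom W (shift X)),
    dist f a b -> dist g c d -> dist (g \oc f) p q ->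
    exists (u : hom U W) (v : hom W V),
      dist u v (fmap shift a \oc d) /\
      [/\ u \oc a = p \oc g, q \oc u = b, v \oc p = c &
          d \oc v = fmap shift f \oc q]
}.
Arguments dist {t X Y Z} f g h : rename.

Section Triangulated.
Variable C : triangulated.

(* The class P[1], closed up under isomorphisms. *)
Definition shifted (P : C -> Prop) : C -> Prop :=
  fun X => exists Y : C, P Y /\ isomorphic X (shift C Y).

(* The class P[-1], closed up under isomorphisms. *)
Definition unshifted (P : C -> Prop) : C -> Prop :=
  fun X => exists Y : C, P Y /\ isomorphic (shift C X) Y.

Definition cohomological (H : presheaf C) : Prop :=
  additive_presheaf H /\
  forall (X Y Z : C) (f : hom X Y) (g : hom Y Z) (h : hom Z (shift C X)),
    dist f g h ->
    forall y : sections H Y,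
      pullback H f y = 0 <-> exists z : sections H Z, pullback H g z = y.

Definition brown_representability : Prop :=
  forall H : presheaf C, cohomological H -> respects_products H ->
    representable H.

Record weight_structure := WeightStructure {
  w_le0 : C -> Prop;
  w_ge0 : C -> Prop;
  w_le0_retracts : closed_under_retracts w_le0;
  w_ge0_retracts : closed_under_retracts w_ge0;
  w_le0_shift : forall X : C, w_le0 X -> shifted w_le0 X;
  w_ge0_shift : forall X : C, shifted w_ge0 X -> w_ge0 X;
  w_orthogonal : forall X Y : C, w_le0 X -> shifted w_ge0 Y ->
    forall f : hom X Y, f = 0;
  w_decomposition : forall M : C,
    exists (L R : C) (i : hom L M) (p : hom M R) (d : hom R (shift C L)),
      [/\ w_le0 L, shifted w_ge0 R & dist i p d]
}.

Definition w_heart (w : weight_structure) : preadditive :=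
  @full_subpreadditive C (fun X => w_le0 w X /\ w_ge0 w X).

Definition smashing (w : weight_structure) : Prop :=
  has_coproducts C /\ closed_under_coproducts (w_ge0 w).

Record t_structure := TStructure {
  t_le0 : C -> Prop;
  t_ge0 : C -> Prop;
  t_le0_iso : closed_under_iso t_le0;
  t_ge0_iso : closed_under_iso t_ge0;
  t_le0_shift : forall X : C, shifted t_le0 X -> t_le0 X;
  t_ge0_shift : forall X : C, t_ge0 X -> shifted t_ge0 X;
  t_orthogonal : forall X Y : C, t_le0 X -> unshifted t_ge0 Y ->
    forall f : hom X Y, f = 0;
  t_decomposition : forall M : C,
    exists (L R : C) (i : hom L M) (p : hom M R) (d : hom R (shift C L)),
      [/\ t_le0 L, unshifted t_ge0 R & dist i p d]
}.

Definition t_heart (t : t_structure) : category :=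
  @full_subpreadditive C (fun X => t_le0 t X /\ t_ge0 t X).

Definition right_adjacent (t : t_structure) (w : weight_structure) : Prop :=
  forall X : C, t_le0 t X <-> w_ge0 w X.

End Triangulated.

(* Main.v *)
From HB Require Import structures.
From mathcomp Require Import all_boot ssralg.
From mathcomp Require Import generic_quotient ring_quotient boolp.
Require Import Defs.

Set Implicit Arguments.
Unset Strict Implicit.
Unset Printing Implicit Defensive.

Import GRing.Theory.
Import Quotient.
Local Open Scope ring_scope.
Local Open Scope quotient_scope.

(** Write [W] for the full subcategory on the positive class [w_ge0 w], [X[1]]
    for the suspension, and [v^*] for the map that a presheaf assigns to [v].

    If [t] is right adjacent to [w], then [w_ge0 w] consists of the objects
    without nonzero morphisms to [unshifted (t_ge0 t)], so it is closed under
    coproducts and [w] is smashing.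

    The converse and the description of the heart both rest on a Brown
    representability theorem for [W] ([positive_representable]): if [w] is
    smashing, every additive presheaf [N] on [W] that converts the coproducts
    of [C] into products and is exact at [N Q] for each distinguished triangle
    P -> Q -> D -> P[1] with P, Q, D in [W] is representable by an object of
    [W]. Every object X of [C] has a weak reflection p : X -> P in [W], by a
    weight decomposition of X[1]. Extend [N] to [C] by sending X to the
    quotient of [N P] by the sections [a^* z] with a : P -> Q in [W] and
    [a p = 0]. This is the left Kan extension of [N]: its elements are classes
    [el a z] of pairs (a : X -> Q, z in N Q). The main point is [el_eq0]: the
    class of (a, z) vanishes only if z = b^* t for some b with [b a = 0]; a
    cone plays the role of a pushout here, and stays in [W] because [w_ge0 w]
    is closed under cones. It follows formally that the extension is
    cohomological and respects products, so that it is representable; it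
    vanishes on objects X with X[1] in [w_le0 w], which puts the representing
    object in [W].

    For N = C(-, M) this yields a coreflection L -> M from [w_ge0 w]. As the
    class is closed under extensions, the cone of L -> M receives no nonzero
    morphism from it, and these triangles are the decompositions of the
    t-structure ([adjacent_t_structure]).

    For the heart of a right adjacent [t], send X to C(-, X) restricted to the
    heart [H] of [w]. Each Q in [W] sits in a triangle V -> A -> Q -> V[1] with
    A in [H] and V in [W], and V has a heart cover in turn; a morphism from V[1]
    to an object of the heart of [t] is zero. This gives full faithfulness
    ([heart_dense]). For essential surjectivity, extend a presheaf [G] on [H] to
    [W] by sending Q to the group of natural transformations from C(-, Q) on [H]
    to [G], realized inside [G A]. Since C(B, -) is right exact on triangles in
    [W] for B in [H], this right Kan extension is half exact. That it respects
    products uses that a coproduct of presentations of objects of [W] by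
    objects of [H] is a presentation ([presentation_coproduct]); this is where
    [t] enters, as it detects [w_ge0 w] by morphisms out of an object. The
    representing object lies in the heart of [t], as the extension vanishes on
    [w_ge0 w] shifted by one. *)

(** * Subgroups, quotients and bijections of abelian groups *)

(** Bundles a function that preserves addition as an additive map. *)
Section MakeAdditive.
Variables (U V : zmodType) (f : U -> V).
Hypothesis fD : forall x y, f (x + y) = f x + f y.

Lemma nmod_morphism_of_additive : nmod_morphism f.
Proof. by split=> //; apply: (addrI (f 0)); rewrite -fD !addr0. Qed.

Definition mk_additive : {additive U -> V} :=
  HB.pack f (GRing.isNmodMorphism.Build U V f nmod_morphism_of_additive).

End MakeAdditive.

(** A subgroup of an abelian group, given by a propositional predicate. *)
Record zmod_class (U : zmodType) := ZmodClass {
  zmod_mem :> U -> Prop;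
  zmod_mem0 : zmod_mem 0;
  zmod_memB : forall x y, zmod_mem x -> zmod_mem y -> zmod_mem (x - y)
}.

Section SubQuotient.
Variables (U : zmodType) (K : zmod_class U).

Definition zmod_bool (x : U) : bool := `[< K x >].

Lemma zmod_bool_closed : zmod_closed zmod_bool.
Proof.
split=> [|x y /asboolP Kx /asboolP Ky]; apply/asboolP; first exact: zmod_mem0.
exact: zmod_memB.
Qed.

HB.instance Definition _ :=
  GRing.isZmodClosed.Build U zmod_bool zmod_bool_closed.

Definition zmod_bool_class : zmodClosed U :=
  HB.pack zmod_bool (GRing.isZmodClosed.Build U zmod_bool zmod_bool_closed).

(** The quotient of [U] by the subgroup [K]. *)
Definition quo : zmodType := {quot zmod_bool_class}.

Definition quo_pi : {additive U -> quo} := \pi_({quot zmod_bool_class}).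

Lemma quo_pi_surj (z : quo) : exists x, quo_pi x = z.
Proof. by exists (repr z); exact: reprK. Qed.

Lemma quo_pi_eq (x y : U) : quo_pi x = quo_pi y <-> K (x - y).
Proof.
split=> [e|Kxy]; first by apply/asboolP; move/eqP: e; rewrite -idealrBE.
by apply/eqP; rewrite -(idealrBE zmod_bool_class); apply/asboolP.
Qed.

Definition sub_carrier := {x : U | zmod_bool x}.
HB.instance Definition _ := SubChoice.on sub_carrier.
HB.instance Definition _ :=
  [SubChoice_isSubZmodule of sub_carrier by <:].

(** The subgroup [K] as an abelian group of its own. *)
Definition subgrp : zmodType := sub_carrier.

Definition subgrp_val : {additive subgrp -> U} := val.

Lemma subgrp_val_inj : injective subgrp_val.
Proof. exact: val_inj. Qed.

Lemma subgrp_valP (x : subgrp) : K (subgrp_val x).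
Proof. by apply/asboolP; exact: (valP x). Qed.

Lemma subgrp_sub (x : U) : K x -> exists y : subgrp, subgrp_val y = x.
Proof. by move=> /asboolP Kx; exists (exist _ x Kx). Qed.

End SubQuotient.
Arguments subgrp_val {U K}.

Lemma quo_mapD (U V : zmodType) (K : zmod_class U) (K' : zmod_class V)
    (f : {additive U -> V}) : (forall x, K x -> K' (f x)) ->
  forall z z' : quo K, quo_pi K' (f (repr (z + z'))) =
    quo_pi K' (f (repr z)) + quo_pi K' (f (repr z')).
Proof.
move=> fK z z'; rewrite -!raddfD; apply/quo_pi_eq; rewrite -raddfB; apply: fK.
by apply/quo_pi_eq; rewrite raddfD /= !reprK.
Qed.

(** The map induced on quotients by an additive map that sends the first
    subgroup into the second. *)
Definition quo_map (U V : zmodType) (K : zmod_class U) (K' : zmod_class V)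
    (f : {additive U -> V}) (fK : forall x, K x -> K' (f x)) :
  {additive quo K -> quo K'} := mk_additive (quo_mapD fK).

Lemma quo_mapE (U V : zmodType) (K : zmod_class U) (K' : zmod_class V)
    (f : {additive U -> V}) (fK : forall x, K x -> K' (f x)) (x : U) :
  quo_map fK (quo_pi K x) = quo_pi K' (f x).
Proof.
apply/quo_pi_eq; rewrite -raddfB; apply: fK.
by apply/quo_pi_eq; exact: reprK.
Qed.

Lemma additive_inverse (U V : zmodType) (f : {additive U -> V}) :
  injective f -> (forall y, exists x, f x = y) ->
  exists g : {additive V -> U}, cancel f g /\ cancel g f.
Proof.
move=> f_inj f_surj; pose g y := sval (cid (f_surj y)).
have gK : cancel g f by move=> y; rewrite /g; case: (cid _).
have gD x y : g (x + y) = g x + g y.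
  by apply: f_inj; rewrite raddfD /= !gK.
by exists (mk_additive gD); split=> //= x; apply: f_inj; rewrite /= gK.
Qed.

(** * Categories, coproducts and presheaves *)

Section Categories.
Variable C : category.

Lemma iso_sym (X Y : C) : isomorphic X Y -> isomorphic Y X.
Proof. by case=> f [g [gf fg]]; exists g, f. Qed.

Lemma iso_trans (X Y Z : C) :
  isomorphic X Y -> isomorphic Y Z -> isomorphic X Z.
Proof.
case=> f [f' [f'f ff']] [g [g' [g'g gg']]]; exists (g \oc f), (f' \oc g').
split; first by rewrite -comp_assoc (comp_assoc g') g'g comp_idl.
by rewrite -comp_assoc (comp_assoc f) ff' comp_idl.
Qed.

Lemma iso_retract (X Y : C) : isomorphic X Y -> retract_of Y X.
Proof. by case=> f [g [gf fg]]; exists g, f. Qed.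

Lemma retracts_iso (P : C -> Prop) :
  closed_under_retracts P -> closed_under_iso P.
Proof. by move=> Pr X Y /iso_retract r /(Pr _ _ r). Qed.

Lemma coproduct_ext (I : small) (X : I -> C) (S : C)
    (inj : forall i, hom (X i) S) (Y : C) (f g : hom S Y) :
  is_coproduct inj -> (forall i, f \oc inj i = g \oc inj i) -> f = g.
Proof.
move=> Scop fg; have [h [_ hu]] := Scop Y (fun i => g \oc inj i).
by rewrite -(hu g) // (hu f).
Qed.

Lemma coproduct_map (I : small) (X : I -> C) (S : C)
    (inj : forall i, hom (X i) S) (Y : C) (f : forall i, hom (X i) Y) :
  is_coproduct inj -> exists g : hom S Y, forall i, g \oc inj i = f i.
Proof. by move=> Scop; have [h [hf _]] := Scop Y f; exists h. Qed.

Lemma coproduct_iso (I : small) (X : I -> C) (S T : C)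
    (inj : forall i, hom (X i) S) (inj' : forall i, hom (X i) T) :
  is_coproduct inj -> is_coproduct inj' ->
  exists (f : hom S T) (g : hom T S),
    [/\ g \oc f = idc S, f \oc g = idc T & forall i, f \oc inj i = inj' i].
Proof.
move=> Sc Tc; have [f fi] := coproduct_map inj' Sc.
have [g gi] := coproduct_map inj Tc; exists f, g; split=> //.
  by apply: (coproduct_ext Sc) => i; rewrite -comp_assoc fi gi comp_idl.
by apply: (coproduct_ext Tc) => i; rewrite -comp_assoc gi fi comp_idl.
Qed.

End Categories.

Lemma fmap_iso (C D : category) (F : functor C D) (X Y : C) :
  isomorphic X Y -> isomorphic (F X) (F Y).
Proof.
case=> f [g [gf fg]]; exists (fmap F f), (fmap F g).
by rewrite -!fmap_comp gf fg !fmap_id.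
Qed.

Definition fully_faithful (C D : category) (F : functor C D) : Prop :=
  forall (X Y : C) (g : hom (F X) (F Y)), exists! f : hom X Y, fmap F f = g.

Definition essentially_surjective (C D : category) (F : functor C D) : Prop :=
  forall Y : D, exists X : C, isomorphic (F X) Y.

Lemma natural_iso_components (C D : category) (F G : functor C D) :
  naturally_isomorphic F G ->
  exists (a : nat_trans F G) (b : nat_trans G F),
    (forall X, b X \oc a X = idc (F X)) /\ (forall X, a X \oc b X = idc (G X)).
Proof.
case=> a [b [ba ab]]; exists a, b; split=> X.
  exact: (congr1 (fun c : nat_trans F F => c X) ba).
exact: (congr1 (fun c : nat_trans G G => c X) ab).
Qed.

Lemma natural_iso_of_components (C D : category) (F G : functor C D)
    (a : nat_trans F G) : (forall X, is_iso (a X)) ->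
  @is_iso (functor_category C D) F G a.
Proof.
move=> a_iso; pose b X := sval (cid (a_iso X)).
have ba X : b X \oc a X = idc _ by rewrite /b; case: (cid _) => ? [].
have ab X : a X \oc b X = idc _ by rewrite /b; case: (cid _) => ? [].
have b_nat (X Y : C) (f : hom X Y) : b Y \oc fmap G f = fmap F f \oc b X.
  rewrite -[fmap G f]comp_idr -(ab X) (comp_assoc (fmap G f)) -nt_natural.
  by rewrite !comp_assoc ba comp_idl.
by exists (NatTrans b_nat); split; apply: nat_trans_eq.
Qed.

Section Equivalences.
Variables (C D : category) (F : functor C D).

Lemma equivalence_faithful (G : functor D C) :
  naturally_isomorphic (functor_comp G F) (functor_id C) ->
  forall (X Y : C) (f f' : hom X Y), fmap F f = fmap F f' -> f = f'.
Proof.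
move=> /natural_iso_components[a [b [ba ab]]] X Y f f' ff'.
rewrite -[f]comp_idr -[f']comp_idr -(ab X) !comp_assoc.
have := nt_natural a f; have := nt_natural a f' => /= <- <-.
by rewrite ff'.
Qed.

End Equivalences.

Lemma equivalence_fully_faithful (C D : category) (F : functor C D) :
  is_equivalence F -> fully_faithful F.
Proof.
case=> G [GF FG] X Y g.
have [a [b [ba ab]]] := natural_iso_components GF.
pose f : hom X Y := a Y \oc fmap G g \oc b X.
have fE : fmap F f = g.
  apply: (equivalence_faithful FG).
  have : a Y \oc fmap G (fmap F f) = a Y \oc fmap G g.
    rewrite (nt_natural a f) /= /f -!comp_assoc ba.
    by rewrite comp_idr.
  move=> /(congr1 (fun h => b Y \oc h)).
  by rewrite !comp_assoc ba !comp_idl.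
exists f; split=> // f' f'E; apply: (equivalence_faithful GF).
by rewrite fE f'E.
Qed.

Lemma equivalence_essentially_surjective (C D : category) (F : functor C D) :
  is_equivalence F -> essentially_surjective F.
Proof.
case=> G [_ FG] Y; have [a [b [ba ab]]] := natural_iso_components FG.
exists (G Y), (a Y), (b Y); split; [exact: ba | exact: ab].
Qed.

Lemma fully_faithful_comp_eq (C D : category) (F : functor C D) (X Y : C)
    (f g : hom X Y) : fully_faithful F -> fmap F f = fmap F g -> f = g.
Proof.
move=> Fff fg; have [h [_ hu]] := Fff _ _ (fmap F g).
by rewrite -(hu g) // (hu f).
Qed.

(** A fully faithful and essentially surjective functor is an equivalence; the
    quasi-inverse is obtained by choosing preimages. *)
Section FullyFaithful.
Variables (C D : category) (F : functor C D).
Hypotheses (Fff : fully_faithful F) (Fes : essentially_surjective F).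

Definition quasi_inverse_obj (Y : D) : C := sval (cid (Fes Y)).

Lemma counit_ex (Y : D) :
  exists p : hom (F (quasi_inverse_obj Y)) Y * hom Y (F (quasi_inverse_obj Y)),
  p.2 \oc p.1 = idc _ /\ p.1 \oc p.2 = idc _.
Proof.
rewrite /quasi_inverse_obj; case: (cid _) => X /= [e [e' [e'e ee']]].
by exists (e, e').
Qed.

Let e Y := (sval (cid (counit_ex Y))).1.
Let e' Y := (sval (cid (counit_ex Y))).2.
Let e'e Y : e' Y \oc e Y = idc _ := (svalP (cid (counit_ex Y))).1.
Let ee' Y : e Y \oc e' Y = idc _ := (svalP (cid (counit_ex Y))).2.

Definition quasi_inverse_map (X Y : D) (g : hom X Y) :
    hom (quasi_inverse_obj X) (quasi_inverse_obj Y) :=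
  sval (cid (Fff (e' Y \oc g \oc e X))).

Let mapE X Y (g : hom X Y) :
  fmap F (quasi_inverse_map g) = e' Y \oc g \oc e X.
Proof. by rewrite /quasi_inverse_map; case: (cid _) => ? []. Qed.

Lemma quasi_inverse_id X :
  quasi_inverse_map (idc X) = idc (quasi_inverse_obj X).
Proof.
by apply: (fully_faithful_comp_eq Fff); rewrite mapE comp_idr e'e fmap_id.
Qed.

Lemma quasi_inverse_comp (X Y Z : D) (g : hom Y Z) (f : hom X Y) :
  quasi_inverse_map (g \oc f) = quasi_inverse_map g \oc quasi_inverse_map f.
Proof.
apply: (fully_faithful_comp_eq Fff); rewrite fmap_comp !mapE !comp_assoc.
by rewrite -(comp_assoc _ (e Y)) ee' comp_idr.
Qed.

Definition quasi_inverse : functor D C :=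
  @Functor D C quasi_inverse_obj quasi_inverse_map
    quasi_inverse_id quasi_inverse_comp.

Lemma ff_es_equivalence : is_equivalence F.
Proof.
have eN (X Y : D) (g : hom X Y) :
    e Y \oc fmap (functor_comp F quasi_inverse) g = fmap (functor_id D) g \oc e X.
  by rewrite /= mapE !comp_assoc ee' comp_idl.
pose u (X : C) : hom (quasi_inverse_obj (F X)) X := sval (cid (Fff (e (F X)))).
have uE X : fmap F (u X) = e (F X) by rewrite /u; case: (cid _) => ? [].
have uN (X Y : C) (f : hom X Y) :
    u Y \oc fmap (functor_comp quasi_inverse F) f = fmap (functor_id C) f \oc u X.
  apply: (fully_faithful_comp_eq Fff); rewrite /= !fmap_comp !uE mapE !comp_assoc.
  by rewrite ee' comp_idl.
exists quasi_inverse; split.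
  exists (@NatTrans C C (functor_comp quasi_inverse F) (functor_id C) u uN).
  apply: natural_iso_of_components => X /=.
  have [v [vE _]] := Fff (e' (F X)); exists v.
  by split; apply: (fully_faithful_comp_eq Fff);
    rewrite fmap_comp vE uE ?e'e ?ee' fmap_id.
exists (@NatTrans D D (functor_comp F quasi_inverse) (functor_id D) e eN).
apply: natural_iso_of_components => Y /=.
by exists (e' Y).
Qed.

End FullyFaithful.

Section Preadditive.
Variable A : preadditive.
Implicit Types X Y Z : A.

Lemma compDl X Y Z (g g' : hom Y Z) (f : hom X Y) :
  (g + g' : hom Y Z) \oc f = g \oc f + g' \oc f.
Proof. exact: pcompDl. Qed.

Lemma compDr X Y Z (g : hom Y Z) (f f' : hom X Y) :
  g \oc (f + f' : hom X Y) = g \oc f + g \oc f'.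
Proof. exact: pcompDr. Qed.

Lemma comp0l X Y Z (f : hom X Y) : (0 : hom Y Z) \oc f = 0.
Proof. by apply: (addrI ((0 : hom Y Z) \oc f)); rewrite -compDl !addr0. Qed.

Lemma comp0r X Y Z (g : hom Y Z) : g \oc (0 : hom X Y) = 0.
Proof. by apply: (addrI (g \oc (0 : hom X Y))); rewrite -compDr !addr0. Qed.

Lemma compNl X Y Z (g : hom Y Z) (f : hom X Y) : (- g : hom Y Z) \oc f = - (g \oc f).
Proof. by apply: (addrI (g \oc f)); rewrite -compDl !subrr comp0l. Qed.

Lemma compNr X Y Z (g : hom Y Z) (f : hom X Y) : g \oc (- f : hom X Y) = - (g \oc f).
Proof. by apply: (addrI (g \oc f)); rewrite -compDr !subrr comp0r. Qed.

Lemma compBl X Y Z (g g' : hom Y Z) (f : hom X Y) :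
  (g - g' : hom Y Z) \oc f = g \oc f - g' \oc f.
Proof. by rewrite compDl compNl. Qed.

Lemma compBr X Y Z (g : hom Y Z) (f f' : hom X Y) :
  g \oc (f - f' : hom X Y) = g \oc f - g \oc f'.
Proof. by rewrite compDr compNr. Qed.

End Preadditive.

Section AdditiveFunctor.
Variables (A B : preadditive) (F : functor A B).
Hypothesis F_add : additive_functor F.

Lemma fmap0 (X Y : A) : fmap F (0 : hom X Y) = 0.
Proof. by apply: (addrI (fmap F (0 : hom X Y))); rewrite -F_add !addr0. Qed.

End AdditiveFunctor.

Section Presheaves.
Variables (A : preadditive) (F : presheaf A).

Lemma pullback_id (X : A) (x : sections F X) : pullback F (idc X) x = x.
Proof.
exact: (congr1 (fun h : {additive sections F X -> sections F X} => h x)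
  (fmap_id F X)).
Qed.

Lemma pullback_comp (X Y Z : A) (g : hom Y Z) (f : hom X Y) (z : sections F Z) :
  pullback F (g \oc f) z = pullback F f (pullback F g z).
Proof.
exact: (congr1 (fun h : {additive sections F Z -> sections F X} => h z)
  (@fmap_comp _ _ F Z Y X f g)).
Qed.

Section Additive.
Hypothesis F_add : additive_presheaf F.

Lemma pullback0 (X Y : A) (y : sections F Y) : pullback F (0 : hom X Y) y = 0.
Proof.
by apply: (addrI (pullback F (0 : hom X Y) y)); rewrite -F_add !addr0.
Qed.

Lemma pullbackN (X Y : A) (f : hom X Y) (y : sections F Y) :
  pullback F (- f) y = - pullback F f y.
Proof.
by apply: (addrI (pullback F f y)); rewrite -F_add !subrr pullback0.
Qed.

Lemma pullbackB (X Y : A) (f g : hom X Y) (y : sections F Y) :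
  pullback F (f - g) y = pullback F f y - pullback F g y.
Proof. by rewrite F_add pullbackN. Qed.

End Additive.

(** The Yoneda lemma: a representable presheaf has a universal element. *)
Lemma representable_universal : representable F ->
  exists (T : A) (u : sections F T), forall (X : A) (x : sections F X),
    exists! f : hom X T, pullback F f u = x.
Proof.
case=> T /natural_iso_components[a [b [ba ab]]].
have b_nat (X : A) (f : hom X T) : b X f = pullback F f (b T (idc T)).
  have := congr1 (fun h : {additive phom T T -> sections F X} => h (idc T))
    (@nt_natural _ _ _ _ b T X f).
  by rewrite /= /precomp pcomp_idl.
have baE X (x : sections F X) : b X (a X x) = x.
  exact: (congr1 (fun h : {additive sections F X -> sections F X} => h x) (ba X)).
have abE X (f : phom X T) : a X (b X f) = f.
  exact: (congr1 (fun h : {additive phom X T -> phom X T} => h f) (ab X)).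
exists T, (b T (idc T)) => X x; exists (a X x); split=> [|f <-].
  by rewrite -b_nat baE.
by rewrite -b_nat abE.
Qed.

End Presheaves.

(** Builds a presheaf from a contravariant action by additive maps. *)
Section MakePresheaf.
Variables (A : preadditive) (S : A -> zmodType).
Variable m : forall X Y : A, hom X Y -> {additive S Y -> S X}.
Hypothesis m_id : forall (X : A) (x : S X), m (idc X) x = x.
Hypothesis m_comp : forall (X Y Z : A) (g : hom Y Z) (f : hom X Y) (z : S Z),
  m (g \oc f) z = m f (m g z).

Lemma mk_presheaf_id (X : A) : m (idc X) = idfun :> {additive S X -> S X}.
Proof. by apply: additive_eq => x; rewrite m_id. Qed.

Lemma mk_presheaf_comp (X Y Z : A) (f : hom Y X) (g : hom Z Y) :
  m (f \oc g) = m g \o m f :> {additive S X -> S Z}.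
Proof. by apply: additive_eq => x; rewrite m_comp. Qed.

Definition mk_presheaf : presheaf A :=
  @Functor (opposite A) Ab S (fun X Y f => m f) mk_presheaf_id
    (fun X Y Z g f => mk_presheaf_comp f g).

End MakePresheaf.

(** The restriction of a presheaf to the full subcategory on a class [P]. *)
Definition restriction (A : preadditive) (P : A -> Prop) (F : presheaf A) :
    presheaf (full_subpreadditive P) :=
  @Functor (opposite (full_subpreadditive P)) Ab (fun X => F (sval X))
    (fun X Y f => fmap F f) (fun X => fmap_id F (sval X))
    (fun X Y Z g f => @fmap_comp _ _ F (sval X) (sval Y) (sval Z) g f).

(** * Exactness of hom functors on distinguished triangles *)

Section TriangulatedLemmas.
Variable C : triangulated.
Local Notation T := (shift C).

Lemma shift_ff : fully_faithful T.
Proof. exact: equivalence_fully_faithful (shift_equivalence C). Qed.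

Lemma shift_full (X Y : C) (g : hom (T X) (T Y)) :
  exists f : hom X Y, fmap T f = g.
Proof. by have [f [fE _]] := shift_ff g; exists f. Qed.

Lemma shift_inj (X Y : C) (f g : hom X Y) : fmap T f = fmap T g -> f = g.
Proof. exact: fully_faithful_comp_eq shift_ff. Qed.

Lemma shift0 (X Y : C) : fmap T (0 : hom X Y) = 0.
Proof. exact/fmap0/shift_additive. Qed.

Lemma desuspension (Y : C) : exists X : C, isomorphic (T X) Y.
Proof. exact: equivalence_essentially_surjective (shift_equivalence C) Y. Qed.

Lemma id_is_iso (X : C) : is_iso (idc X).
Proof. by exists (idc X); rewrite comp_idl. Qed.

Lemma dist_comp0 (X Y Z : C) (f : hom X Y) (g : hom Y Z) (h : hom Z (T X)) :
  dist f g h -> g \oc f = 0.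
Proof.
move=> fgh; have [[Z0 Z0P] _] := tcat_additive C.
have [c [cE _]] : exists c : hom Z0 Z,
    c \oc (0 : hom X Z0) = g \oc f /\ fmap T (idc X) \oc (0 : hom Z0 (T X)) = h \oc c.
  by apply: dist_morphism (dist_id X Z0P) fgh _; rewrite !comp_idr.
by rewrite -cE comp0r.
Qed.

Lemma dist_rot (X Y Z : C) (f : hom X Y) (g : hom Y Z) (h : hom Z (T X)) :
  dist f g h -> dist g h (- fmap T f).
Proof. by move=> /dist_rotate. Qed.

(** Exactness of Hom(W, -) at the middle of a distinguished triangle. *)
Lemma dist_lift (X Y Z : C) (f : hom X Y) (g : hom Y Z) (h : hom Z (T X)) :
  dist f g h -> forall (W : C) (x : hom W Y), g \oc x = 0 ->
  exists y : hom W X, x = f \oc y.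
Proof.
move=> fgh W x gx0; have [[Z0 Z0P] _] := tcat_additive C.
have [c [_ cE]] := dist_morphism (a := x) (b := (0 : hom Z0 Z))
  (dist_rot (dist_id W Z0P)) (dist_rot fgh) (etrans (comp0l _ _) (esym gx0)).
have [y yE] := shift_full c; exists y; apply: shift_inj.
move: cE; rewrite -yE fmap_id compNr comp_idr compNl -fmap_comp.
exact: oppr_inj.
Qed.

Lemma dist_zero_id (W Z0 : C) : is_zero Z0 ->
  dist (0 : hom Z0 W) (idc W) (0 : hom W (T Z0)).
Proof.
move=> Z0P; apply/dist_rotate; rewrite shift0 oppr0; apply: dist_id => X.
have idZ : idc (T Z0) = 0.
  by rewrite -fmap_id -shift0; congr fmap; case: (Z0P Z0).
split=> f; first by rewrite -[f]comp_idl idZ comp0l.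
by rewrite -[f]comp_idr idZ comp0r.
Qed.

(** Exactness of Hom(-, W) at the middle of a distinguished triangle. *)
Lemma dist_extend (X Y Z : C) (f : hom X Y) (g : hom Y Z) (h : hom Z (T X)) :
  dist f g h -> forall (W : C) (x : hom Y W), x \oc f = 0 ->
  exists y : hom Z W, x = y \oc g.
Proof.
move=> fgh W x xf0; have [[Z0 Z0P] _] := tcat_additive C.
have [c [cE _]] := dist_morphism (a := (0 : hom X Z0)) (b := x)
  fgh (dist_zero_id W Z0P) (etrans xf0 (esym (comp0r _ _))).
by exists c; rewrite cE comp_idl.
Qed.

(** Exactness at the other places of the long exact sequences. *)
Section Exactness.
Variables (X Y Z : C) (f : hom X Y) (g : hom Y Z) (h : hom Z (T X)).
Hypothesis fgh : dist f g h.

Lemma dist_comp0_shift : fmap T f \oc h = 0.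
Proof.
have := dist_comp0 (dist_rot (dist_rot fgh)); rewrite compNl => fh0.
by apply: oppr_inj; rewrite oppr0.
Qed.

Lemma dist_lift3 (W : C) (x : hom W Z) : h \oc x = 0 ->
  exists y : hom W Y, x = g \oc y.
Proof. exact: dist_lift (dist_rot fgh) W x. Qed.

Lemma dist_extend3 (W : C) (x : hom Z W) : x \oc g = 0 ->
  exists y : hom (T X) W, x = y \oc h.
Proof. exact: dist_extend (dist_rot fgh) W x. Qed.

Lemma dist_lift4 (W : C) (x : hom W (T X)) : fmap T f \oc x = 0 ->
  exists y : hom W Z, x = h \oc y.
Proof.
move=> fx0; apply: (dist_lift (dist_rot (dist_rot fgh))).
by rewrite compNl fx0 oppr0.
Qed.

Lemma dist_extend4 (W : C) (x : hom (T X) W) : x \oc h = 0 ->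
  exists y : hom (T Y) W, x = y \oc fmap T f.
Proof.
move=> /(dist_extend (dist_rot (dist_rot fgh)))[y yE].
by exists (- y); rewrite yE compNl compNr.
Qed.

Lemma dist_lift_shift (W : C) (x : hom W (T Y)) : fmap T g \oc x = 0 ->
  exists y : hom W (T X), x = fmap T f \oc y.
Proof.
move=> gx0; have [|y yE] := dist_lift (dist_rot (dist_rot (dist_rot fgh))) (x := x).
  by rewrite compNl gx0 oppr0.
by exists (- y); rewrite yE compNl compNr.
Qed.

Lemma dist_lift_shift3 (W : C) (x : hom W (T Z)) : fmap T h \oc x = 0 ->
  exists y : hom W (T Y), x = fmap T g \oc y.
Proof.
move=> hx0.
have [|y yE] := dist_lift (dist_rot (dist_rot (dist_rot (dist_rot fgh)))) (x := x).
  by rewrite compNl hx0 oppr0.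
by exists (- y); rewrite yE compNl compNr.
Qed.

End Exactness.

(** Every morphism is the second one of a distinguished triangle. *)
Lemma dist_fiber (X Y : C) (v : hom X Y) :
  exists (V : C) (k : hom V X) (d : hom Y (T V)), dist k v d.
Proof.
have [W [g [h vgh]]] := dist_cone v; have [V [e [e' [e'e ee']]]] := desuspension W.
have [k kE] := shift_full (- (h \oc e)).
exists V, k, (e' \oc g); apply/dist_rotate; rewrite kE opprK.
apply: (dist_iso (a := idc X) (b := idc Y) (c := e') _ _ _ _ _ _ vgh);
  rewrite ?comp_idl ?comp_idr //; try exact: id_is_iso.
  by exists e.
by rewrite fmap_id comp_idl -comp_assoc ee' comp_idr.
Qed.

Lemma coproduct_shift (I : small) (X : I -> C) (S : C)
    (inj : forall i, hom (X i) S) :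
  is_coproduct inj -> is_coproduct (fun i => fmap T (inj i)).
Proof.
move=> Scop Y f; have [Y0 [e [e' [e'e ee']]]] := desuspension Y.
pose f0 i := sval (cid (shift_full (e' \oc f i))).
have f0E i : fmap T (f0 i) = e' \oc f i by rewrite /f0; case: (cid _).
have [g gE] := coproduct_map f0 Scop.
exists (e \oc fmap T g); split=> [i|g' g'E].
  by rewrite -comp_assoc -fmap_comp gE f0E comp_assoc ee' comp_idl.
have [g0 g0E] := shift_full (e' \oc g').
have -> : g = g0.
  apply: (coproduct_ext Scop) => i; apply: shift_inj.
  by rewrite gE f0E fmap_comp g0E -comp_assoc g'E.
by rewrite g0E comp_assoc ee' comp_idl.
Qed.

(** The cones of a family of morphisms jointly detect the morphisms out of the
    cone of their coproduct. *)
Lemma cone_coproduct_epi (I : small) (X Y Z : I -> C)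
    (f : forall i, hom (X i) (Y i)) (g : forall i, hom (Y i) (Z i))
    (h : forall i, hom (Z i) (T (X i)))
    (X' Y' Z' : C) (injX : forall i, hom (X i) X') (injY : forall i, hom (Y i) Y')
    (f' : hom X' Y') (g' : hom Y' Z') (h' : hom Z' (T X'))
    (c : forall i, hom (Z i) Z') :
  is_coproduct injX -> is_coproduct injY ->
  (forall i, dist (f i) (g i) (h i)) -> dist f' g' h' ->
  (forall i, f' \oc injX i = injY i \oc f i) ->
  (forall i, c i \oc g i = g' \oc injY i) ->
  (forall i, h' \oc c i = fmap T (injX i) \oc h i) ->
  forall (W : C) (x : hom Z' W), (forall i, x \oc c i = 0) -> x = 0.
Proof.
move=> Xcop Ycop fgh fgh' fE gE hE W x xc0.
have [|y yE] := dist_extend3 fgh' (x := x).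
  apply: (coproduct_ext Ycop) => i.
  by rewrite -comp_assoc -gE comp_assoc xc0 !comp0l.
have yi i : exists z : hom (T (Y i)) W, y \oc fmap T (injX i) = z \oc fmap T (f i).
  apply: (dist_extend4 (fgh i)).
  by rewrite -comp_assoc -hE comp_assoc -yE xc0.
have [z zE] := coproduct_map (fun i => sval (cid (yi i))) (coproduct_shift Ycop).
have -> : x = z \oc fmap T f' \oc h'.
  rewrite yE; congr comp; apply: (coproduct_ext (coproduct_shift Xcop)) => i.
  rewrite -comp_assoc -fmap_comp fE fmap_comp comp_assoc zE.
  by case: (cid _).
by rewrite -comp_assoc (dist_comp0_shift fgh') comp0r.
Qed.

End TriangulatedLemmas.

(** * Weight structures *)

Section WeightStructures.
Variables (C : triangulated) (w : weight_structure C).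
Local Notation T := (shift C).

Lemma weight_orthogonal (L Q : C) (f : hom L (T Q)) :
  w_le0 w L -> w_ge0 w Q -> f = 0.
Proof.
move=> Lle Qge; apply: (w_orthogonal Lle); exists Q; split=> //.
by exists (idc _); exact: id_is_iso.
Qed.

(** A weight decomposition whose third vertex is literally a suspension. *)
Lemma weight_triangle (M : C) :
  exists (L R : C) (i : hom L M) (p : hom M (T R)) (d : hom (T R) (T L)),
    [/\ w_le0 w L, w_ge0 w R & dist i p d].
Proof.
have [L [R' [i [p [d [Lle [R [Rge [e [e' [e'e ee']]]]] ipd]]]]]] :=
  w_decomposition w M.
exists L, R, i, (e \oc p), (d \oc e'); split=> //.
apply: (dist_iso (a := idc L) (b := idc M) (c := e) _ _ _ _ _ _ ipd);
  rewrite ?comp_idl ?comp_idr //; try exact: id_is_iso.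
  by exists e'.
by rewrite fmap_id comp_idl -comp_assoc e'e comp_idr.
Qed.

(** Hom(L, Q[1]) for [L] in [w_le0] detects [w_ge0]. *)
Lemma ge0_orthogonal (Q : C) :
  w_ge0 w Q <-> forall (L : C) (f : hom L (T Q)), w_le0 w L -> f = 0.
Proof.
split=> [Qge L f Lle|Qo]; first exact: weight_orthogonal.
have [L [R [i [p [d [Lle Rge ipd]]]]]] := weight_triangle (T Q).
have [|y yE] := dist_extend ipd (x := idc _); first by rewrite comp_idl (Qo _ i).
have [p0 p0E] := shift_full p; have [y0 y0E] := shift_full y.
apply: (w_ge0_retracts _ Rge); exists p0, y0; apply: shift_inj.
by rewrite fmap_comp p0E y0E fmap_id.
Qed.

(** Hom(X, Q[1]) for [Q] in [w_ge0] detects [w_le0]. *)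
Lemma le0_orthogonal (X : C) :
  w_le0 w X <-> forall (Q : C) (f : hom X (T Q)), w_ge0 w Q -> f = 0.
Proof.
split=> [Xle Q f Qge|Xo]; first exact: weight_orthogonal.
have [L [R [i [p [d [Lle Rge ipd]]]]]] := weight_triangle X.
have [|y yE] := dist_lift ipd (x := idc _); first by rewrite comp_idr (Xo _ p).
by apply: (w_le0_retracts _ Lle); exists y, i.
Qed.

Lemma ge0_shift (Q : C) : w_ge0 w Q -> w_ge0 w (T Q).
Proof.
move=> Qge; apply: w_ge0_shift; exists Q; split=> //.
by exists (idc _); exact: id_is_iso.
Qed.

Lemma ge0_iso (X Y : C) : isomorphic X Y -> w_ge0 w X -> w_ge0 w Y.
Proof. exact: (retracts_iso (@w_ge0_retracts _ w)). Qed.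

Lemma ge0_cone (P Q D : C) (f : hom P Q) (g : hom Q D) (h : hom D (T P)) :
  dist f g h -> w_ge0 w P -> w_ge0 w Q -> w_ge0 w D.
Proof.
move=> fgh Pge Qge; apply/ge0_orthogonal => L x Lle.
have [|y ->] := dist_lift_shift3 fgh (x := x).
  by apply: (weight_orthogonal _ Lle); exact: ge0_shift.
by rewrite (weight_orthogonal y Lle Qge) comp0r.
Qed.

Lemma ge0_extension (P Q D : C) (f : hom P Q) (g : hom Q D) (h : hom D (T P)) :
  dist f g h -> w_ge0 w P -> w_ge0 w D -> w_ge0 w Q.
Proof.
move=> fgh Pge Dge; apply/ge0_orthogonal => L x Lle.
have [|y ->] := dist_lift_shift fgh (x := x).
  exact: weight_orthogonal.
by rewrite (weight_orthogonal y Lle Pge) comp0r.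
Qed.

Lemma ge0_biproduct (P Q S : C) :
  is_biproduct P Q S -> w_ge0 w P -> w_ge0 w Q -> w_ge0 w S.
Proof.
case=> i [j [p [q [_ _ _ _ e]]]] Pge Qge; apply/ge0_orthogonal => L x Lle.
rewrite -[x]comp_idl -(fmap_id T) -e (shift_additive (i \oc p)) compDl.
rewrite !fmap_comp -!comp_assoc.
by rewrite !(weight_orthogonal (_ \oc x) Lle) // !comp0r addr0.
Qed.

(** Every object has a weak reflection in the class [w_ge0]. *)
Lemma weak_reflection (X : C) :
  exists (P : C) (p : hom X P), w_ge0 w P /\
    forall (Q : C) (a : hom X Q), w_ge0 w Q -> exists a' : hom P Q, a = a' \oc p.
Proof.
(* The reflection desuspends the map X[1] -> P[1] of a decomposition of X[1];
   no morphism from [L] to Q[1] is nonzero. *)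
have [L [P [i [p1 [d [Lle Pge ipd]]]]]] := weight_triangle (T X).
have [p pE] := shift_full p1; exists P, p; split=> // Q a Qge.
have [|y yE] := dist_extend ipd (x := fmap T a).
  exact: weight_orthogonal.
have [a' a'E] := shift_full y; exists a'; apply: shift_inj.
by rewrite fmap_comp a'E pE.
Qed.

(** The class of objects of the heart of [w]. *)
Definition in_heart (X : C) : Prop := w_le0 w X /\ w_ge0 w X.

(** An object [Q] of [w_ge0] is the third vertex of a triangle whose second
    vertex lies in the heart and whose first vertex lies in [w_ge0]; every
    morphism from [w_le0] to [Q] then lifts to the second vertex. *)
Lemma heart_cover (Q : C) : w_ge0 w Q ->
  exists (A V : C) (k : hom V A) (v : hom A Q) (d : hom Q (T V)),
    [/\ in_heart A, w_ge0 w V & dist k v d].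
Proof.
move=> Qge; have [A [V [v [p [d [Ale Vge vpd]]]]]] := weight_triangle Q.
have [k kE] := shift_full (- d); exists A, V, k, v, p.
have kvp : dist k v p by apply/dist_rotate; rewrite kE opprK.
by split=> //; split=> //; exact: ge0_extension kvp Vge Qge.
Qed.

Lemma heart_cover_lift (A V Q : C) (k : hom V A) (v : hom A Q)
    (d : hom Q (T V)) : w_ge0 w V -> dist k v d ->
  forall (B : C) (b : hom B Q), w_le0 w B -> exists b' : hom B A, b = v \oc b'.
Proof.
by move=> Vge kvd B b Ble; apply: (dist_lift3 kvd); exact: weight_orthogonal.
Qed.

End WeightStructures.

(** * Representability over the positive class of a smashing weight structure *)

(** The full subcategory of [C] on the class [w_ge0 w]. *)
Definition positive (C : triangulated) (w : weight_structure C) : preadditive :=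
  full_subpreadditive (w_ge0 w).

Section Brown.
Variables (C : triangulated) (w : weight_structure C).
Local Notation T := (shift C).
Local Notation W := (positive w).
Hypotheses (C_brown : brown_representability C) (w_smash : smashing w).

Section HalfExact.
Variable N : presheaf W.
Hypothesis N_add : additive_presheaf N.

(** The action of [N] on a morphism of [C] between objects of the class. *)
Definition pb (P Q : W) (f : @hom C (sval P) (sval Q)) :
  {additive sections N Q -> sections N P} := @pullback W N P Q f.

Lemma pb_id (P : W) (x : sections N P) : pb (idc (sval P)) x = x.
Proof. exact: (@pullback_id W N P x). Qed.

Lemma pb_comp (P Q R : W) (g : @hom C (sval Q) (sval R))
    (f : @hom C (sval P) (sval Q)) (x : sections N R) :
  pb (g \oc f) x = pb f (pb g x).
Proof. exact: (@pullback_comp W N P Q R g f x). Qed.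

Lemma pbB (P Q : W) (f g : @hom C (sval P) (sval Q)) (x : sections N Q) :
  pb (f - g) x = pb f x - pb g x.
Proof. exact: (@pullbackB W N N_add P Q f g x). Qed.

Lemma pbD (P Q : W) (f g : @hom C (sval P) (sval Q)) (x : sections N Q) :
  pb (f + g) x = pb f x + pb g x.
Proof. exact: N_add. Qed.

Lemma pb0 (P Q : W) (x : sections N Q) :
  pb (0 : @hom C (sval P) (sval Q)) x = 0.
Proof. exact: (@pullback0 W N N_add P Q x). Qed.

Hypothesis N_exact : forall (P Q D : W) (f : @hom C (sval P) (sval Q))
    (g : @hom C (sval Q) (sval D)) (h : hom (sval D) (T (sval P))),
  dist f g h -> forall y : sections N Q, pb f y = 0 ->
  exists z : sections N D, pb g z = y.
Hypothesis N_prod : forall (I : small) (Q : I -> W) (S : W)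
    (inj : forall i, @hom C (sval (Q i)) (sval S)),
  is_coproduct inj -> forall y : (forall i, sections N (Q i)),
  exists! s : sections N S, forall i, pb (inj i) s = y i.

Lemma reflection_ex (X : C) : exists Pp : {P : W & @hom C X (sval P)},
  forall (Q : W) (a : @hom C X (sval Q)),
  exists a' : @hom C (sval (tag Pp)) (sval Q), a' \oc tagged Pp = a.
Proof.
have [P [p [Pge Pp]]] := weak_reflection w X.
exists (existT _ (exist _ P Pge : W) p) => -[Q Qge] a.
by have [a' ->] := Pp Q a Qge; exists a'.
Qed.

(** A chosen weak reflection [refl_unit X : X -> refl X] in [W], and chosen
    factorizations [refl_lift a] through it. *)
Definition refl (X : C) : W := tag (sval (cid (reflection_ex X))).
Definition refl_unit (X : C) : @hom C X (sval (refl X)) :=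
  tagged (sval (cid (reflection_ex X))).

Lemma refl_unitP (X : C) (Q : W) (a : @hom C X (sval Q)) :
  exists a' : @hom C (sval (refl X)) (sval Q), a' \oc refl_unit X = a.
Proof. exact: (svalP (cid (reflection_ex X))). Qed.

Definition refl_lift (X : C) (Q : W) (a : @hom C X (sval Q)) :
  @hom C (sval (refl X)) (sval Q) :=
  sval (cid (refl_unitP a)).

Lemma refl_liftK (X : C) (Q : W) (a : @hom C X (sval Q)) :
  refl_lift a \oc refl_unit X = a.
Proof. by rewrite /refl_lift; case: (cid _). Qed.

(** The sections of [N] on the weak reflection of [X] to be divided out. *)
Definition negligible_mem (X : C) (x : sections N (refl X)) : Prop :=
  exists (Q : W) (a : @hom C (sval (refl X)) (sval Q)) (z : sections N Q),
    a \oc refl_unit X = 0 /\ x = pb a z.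

Lemma negligible0 (X : C) : @negligible_mem X 0.
Proof. by exists (refl X), 0, 0; rewrite comp0l raddf0. Qed.

Lemma negligibleB (X : C) (x y : sections N (refl X)) :
  negligible_mem x -> negligible_mem y -> negligible_mem (x - y).
Proof.
case=> [[P Pge] [a [z [a0 ->]]]] [[Q Qge] [b [t [b0 ->]]]].
have [S Sbi] := (tcat_additive C).2 P Q; have Sge := ge0_biproduct Sbi Pge Qge.
case: Sbi => i [j [p [q [pi qj pj qi _]]]].
pose SW : W := exist _ S Sge.
have pa : p \oc (i \oc a + j \oc b : hom (sval (refl X)) S) = a.
  by rewrite compDr !comp_assoc pi pj comp_idl comp0l addr0.
have qb : q \oc (i \oc a + j \oc b : hom (sval (refl X)) S) = b.
  by rewrite compDr !comp_assoc qi qj comp_idl comp0l add0r.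
exists SW, (i \oc a + j \oc b : hom (sval (refl X)) S).
exists (@pb SW (exist _ P Pge) p z - @pb SW (exist _ Q Qge) q t); split.
  by rewrite compDl -!comp_assoc a0 b0 !comp0r addr0.
by rewrite raddfB -!pb_comp pa qb.
Qed.

Definition negligible (X : C) : zmod_class (sections N (refl X)) :=
  @ZmodClass _ (@negligible_mem X) (@negligible0 X) (@negligibleB X).

(** The value at [X] of the left Kan extension of [N] along the inclusion. *)
Definition ext (X : C) : zmodType := quo (negligible X).

(** The class in [ext X] of the pair of a morphism [a : X -> Q] to an object of
    [W] and a section [z] of [N] on [Q]. *)
Definition el (X : C) (Q : W) (a : @hom C X (sval Q)) (z : sections N Q) :
  ext X := quo_pi (negligible X) (pb (refl_lift a) z).

Lemma elE (X : C) (Q : W) (a : @hom C X (sval Q))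
    (a' : @hom C (sval (refl X)) (sval Q)) (z : sections N Q) :
  a' \oc refl_unit X = a -> quo_pi (negligible X) (pb a' z) = el a z.
Proof.
move=> a'E; apply/quo_pi_eq; exists Q, (a' - refl_lift a), z.
by rewrite compBl a'E refl_liftK subrr pbB.
Qed.

Lemma el_ex (X : C) (s : ext X) : exists z, s = el (refl_unit X) z.
Proof.
have [x <-] := quo_pi_surj s; exists x.
by rewrite -(elE _ (comp_idl (refl_unit X))) pb_id.
Qed.

Lemma el_comp (X : C) (P Q : W) (a : @hom C X (sval P))
    (b : @hom C (sval P) (sval Q)) (z : sections N Q) : el (b \oc a) z = el a (pb b z).
Proof.
rewrite -(elE (a' := b \oc refl_lift a)); first by rewrite pb_comp.
by rewrite -comp_assoc refl_liftK.
Qed.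

Lemma elBr (X : C) (Q : W) (a : @hom C X (sval Q)) (z t : sections N Q) :
  el a (z - t) = el a z - el a t.
Proof. by rewrite /el !raddfB. Qed.

Lemma elDl (X : C) (Q : W) (a b : @hom C X (sval Q)) (z : sections N Q) :
  el (a + b : hom X (sval Q)) z = el a z + el b z.
Proof.
rewrite -(elE (a' := refl_lift a + refl_lift b)); last by rewrite compDl !refl_liftK.
by rewrite pbD raddfD.
Qed.

Lemma el0 (X : C) (Q : W) (z : sections N Q) : el (0 : @hom C X (sval Q)) z = 0.
Proof. by rewrite -(elE z (comp0l _ _)) pb0 raddf0. Qed.

(** A pair represents zero only if the section comes from an object of [W] in
    which the morphism becomes zero. *)
Lemma el_eq0 (X : C) (Q : W) (a : @hom C X (sval Q)) (z : sections N Q) :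
  el a z = 0 ->
  exists (D : W) (b : @hom C (sval Q) (sval D)) (t : sections N D),
    b \oc a = 0 /\ z = pb b t.
Proof.
move=> e.
have [R [c [t [c0 cE]]]] : negligible X (pb (refl_lift a) z).
  by rewrite -[pb _ _]subr0; apply/quo_pi_eq; rewrite raddf0.
have [S Sbi] := (tcat_additive C).2 (sval Q) (sval R).
have Sge := ge0_biproduct Sbi (svalP Q) (svalP R).
case: Sbi => i [j [p [q [pi qj pj qi _]]]].
pose SW : W := exist _ S Sge.
(* The cone of [f] is a weak pushout of [refl_lift a] and [c]. *)
pose f : hom (sval (refl X)) S := i \oc refl_lift a - j \oc c.
have [D [g [h fgh]]] := dist_cone f.
pose DW : W := exist _ D (ge0_cone fgh (svalP (refl X)) Sge).
pose x : sections N SW := @pb SW Q p z + @pb SW R q t.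
have [|d dE] := @N_exact (refl X) SW DW f g h fgh x.
  rewrite raddfD -!pb_comp !compBr !comp_assoc pi pj qi qj.
  by rewrite !comp0l !comp_idl subr0 pbB pb0 sub0r cE subrr.
exists DW, (g \oc i), d; split.
  rewrite -comp_assoc; have -> : i \oc a = f \oc refl_unit X.
    by rewrite compBl -!comp_assoc refl_liftK c0 comp0r subr0.
  by rewrite comp_assoc (dist_comp0 fgh) comp0l.
rewrite (@pb_comp Q SW DW) dE raddfD -!(@pb_comp Q SW) pi qi pb_id.
by rewrite pb0 addr0.
Qed.

Lemma ext_map_negligible (X Y : C) (f : hom X Y) (x : sections N (refl Y)) :
  negligible Y x -> negligible X (pb (refl_lift (refl_unit Y \oc f)) x).
Proof.
case=> Q [a [z [a0 ->]]]; exists Q, (a \oc refl_lift (refl_unit Y \oc f)), z.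
by rewrite pb_comp -comp_assoc refl_liftK comp_assoc a0 comp0l.
Qed.

Definition ext_map (X Y : C) (f : hom X Y) : {additive ext Y -> ext X} :=
  quo_map (@ext_map_negligible X Y f).

Lemma ext_mapE (X Y : C) (f : hom X Y) (Q : W) (a : @hom C Y (sval Q))
    (z : sections N Q) : ext_map f (el a z) = el (a \oc f) z.
Proof.
rewrite /ext_map quo_mapE -pb_comp; apply: elE.
by rewrite -comp_assoc refl_liftK comp_assoc refl_liftK.
Qed.

Lemma ext_map_id (X : C) (s : ext X) : ext_map (idc X) s = s.
Proof. by have [z ->] := el_ex s; rewrite ext_mapE comp_idr. Qed.

Lemma ext_map_comp (X Y Z : C) (g : hom Y Z) (f : hom X Y) (s : ext Z) :
  ext_map (g \oc f) s = ext_map f (ext_map g s).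
Proof. by have [z ->] := el_ex s; rewrite !ext_mapE comp_assoc. Qed.

(** The left Kan extension of [N] to [C]. *)
Definition extension : presheaf C := mk_presheaf ext_map_id ext_map_comp.

Lemma ext_pullback (X Y : C) (f : hom X Y) (Q : W) (a : @hom C Y (sval Q))
    (z : sections N Q) :
  pullback extension f (el a z : sections extension Y) = el (a \oc f) z.
Proof. exact: ext_mapE. Qed.

Lemma extension_additive : additive_presheaf extension.
Proof.
move=> X Y f g s; have [z ->] := el_ex s.
by rewrite !ext_pullback compDr elDl.
Qed.

Lemma extension_cohomological : cohomological extension.
Proof.
split; first exact: extension_additive.
move=> X Y Z f g h fgh y; split=> [|[z <-]]; last first.
  by rewrite -pullback_comp (dist_comp0 fgh) (pullback0 extension_additive).
have [x ->] := el_ex y; rewrite ext_pullback => /el_eq0.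
case=> D [b [t [b0 xE]]].
have [|c cE] := dist_extend fgh (x := b \oc refl_unit Y); first by rewrite -comp_assoc.
by exists (el c t); rewrite ext_pullback -cE el_comp -xE.
Qed.

Lemma positive_coproduct (I : small) (Q : I -> W) :
  exists (S : W) (inj : forall i, @hom C (sval (Q i)) (sval S)), is_coproduct inj.
Proof.
have [S [inj Scop]] := w_smash.1 I (fun i => sval (Q i)).
have Sge := w_smash.2 _ _ _ _ Scop (fun i => svalP (Q i)).
by exists (exist _ S Sge), inj.
Qed.

Lemma extension_products : respects_products extension.
Proof.
move=> I X S inj Scop y.
have inj0 (s : ext S) : (forall i, ext_map (inj i) s = 0) -> s = 0.
  have [z ->] := el_ex s => s0.
  have di i : exists Dbt :
      {D : W & (@hom C (sval (refl S)) (sval D) * sections N D)%type},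
      (tagged Dbt).1 \oc refl_unit S \oc inj i = 0 /\
      z = pb (tagged Dbt).1 (tagged Dbt).2.
    have := s0 i; rewrite ext_mapE => /el_eq0[D [b [t [b0 zE]]]].
    by exists (existT _ D (b, t)); split=> //; rewrite -comp_assoc.
  pose D i : W := tag (sval (cid (di i))).
  pose b i : @hom C (sval (refl S)) (sval (D i)) := (tagged (sval (cid (di i)))).1.
  pose t i : sections N (D i) := (tagged (sval (cid (di i)))).2.
  have b0 i : b i \oc refl_unit S \oc inj i = 0 by case: (svalP (cid (di i))).
  have bE i : z = pb (b i) (t i) by case: (svalP (cid (di i))).
  (* The coproduct [P] of copies of [refl S], with its fold map, replaces
     [refl S], so that the different [b i] combine into one morphism [v]. *)
  have [P [k Pcop]] := positive_coproduct (fun _ : I => refl S).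
  have [E [l Ecop]] := positive_coproduct D.
  have [fold foldE] := coproduct_map (fun _ => idc (sval (refl S))) Pcop.
  have [u uE] := coproduct_map (fun i => k i \oc (refl_unit S \oc inj i)) Scop.
  have [v vE] := coproduct_map (fun i => l i \oc b i) Pcop.
  have [t' [t'E _]] := N_prod Ecop t.
  have zE : pb fold z = pb v t'.
    have [r [_ ru]] := N_prod Pcop (fun=> z).
    rewrite -(ru (pb fold z)) => [|i]; last by rewrite -pb_comp foldE pb_id.
    by apply/ru => i; rewrite -pb_comp vE pb_comp t'E -bE.
  have -> : refl_unit S = fold \oc u.
    apply: (coproduct_ext Scop) => i.
    by rewrite -comp_assoc uE comp_assoc foldE comp_idl.
  rewrite el_comp zE -el_comp -[RHS](@el0 S E t'); congr el.
  apply: (coproduct_ext Scop) => i.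
  rewrite -comp_assoc uE comp_assoc vE -comp_assoc (comp_assoc (b i)) b0.
  by rewrite comp0r comp0l.
have yi i : exists z, y i = el (refl_unit (X i)) z by exact: el_ex.
have [Q [k Qcop]] := positive_coproduct (fun i => refl (X i)).
have [z [zE _]] := N_prod Qcop (fun i => sval (cid (yi i))).
have [u uE] := coproduct_map (fun i => k i \oc refl_unit (X i)) Scop.
have sE i : ext_map (inj i) (el u z) = y i.
  by rewrite ext_mapE uE el_comp zE; case: (cid (yi i)).
exists (el u z); split=> // s' s'E; apply/eqP; rewrite -subr_eq0; apply/eqP.
by apply: inj0 => i; rewrite raddfB sE -(s'E i) subrr.
Qed.

(** A half-exact, product-respecting additive presheaf on the positive class is
    representable there. *)
Lemma positive_representable :
  exists (L : W) (n : sections N L), forall (Q : W) (x : sections N Q),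
    exists! f : @hom C (sval Q) (sval L), pb f n = x.
Proof.
have [L [u uU]] := representable_universal
  (C_brown extension_cohomological extension_products).
have Lge : w_ge0 w L.
  apply/ge0_orthogonal => X f Xle; have [Y [e [e' [e'e ee']]]] := desuspension X.
  (* The extension vanishes on [Y], whose suspension lies in [w_le0]. *)
  have Y0 (s : ext Y) : s = 0.
    have [z ->] := el_ex s; suff -> : refl_unit Y = 0 by rewrite el0.
    apply: shift_inj; rewrite shift0 -[fmap _ _]comp_idr -e'e comp_assoc.
    by rewrite (weight_orthogonal (_ \oc e') Xle (svalP (refl Y))) comp0l.
  have [f0 f0E] := shift_full (f \oc e).
  have f00 : f0 = 0.
    have [g [_ gU]] := uU Y 0; rewrite -(gU f0); last exact: Y0.
    by rewrite -(gU 0) //; exact: Y0.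
  by rewrite -[f]comp_idr -ee' comp_assoc -f0E f00 shift0 comp0l.
pose LW : W := exist _ L Lge; have [z0 uE] := el_ex u.
pose n : sections N LW := @pb LW (refl L) (refl_unit L) z0.
have uEn : u = @el L LW (idc L) n.
  by rewrite uE -(@el_comp L LW (refl L)) comp_idr.
exists LW, n => Q x.
have fE (f : hom (sval Q) L) :
    pullback extension f u = @el (sval Q) Q (idc _) (@pb Q LW f n).
  by rewrite uEn (@ext_pullback _ _ f LW) -(@el_comp _ Q LW) comp_idl comp_idr.
have [f [fU fu]] := uU _ (@el (sval Q) Q (idc _) x).
exists f; split=> [|g gE]; last by apply: fu; rewrite fE gE.
move: fU; rewrite fE => /eqP; rewrite -subr_eq0 -elBr => /eqP /el_eq0.
case=> D [b [t [b0 e]]]; apply/eqP; rewrite -subr_eq0 e.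
by move: b0; rewrite comp_idr => ->; rewrite pb0.
Qed.

End HalfExact.
End Brown.
Arguments pb {C w} N {P Q} f.

(** * The adjacent t-structure *)

Section TStructure.
Variables (C : triangulated) (w : weight_structure C).
Local Notation T := (shift C).

(** The objects that receive no nonzero morphism from the class [w_ge0 w]. *)
Definition right_orth (Y : C) : Prop :=
  forall (Q : C) (f : hom Q Y), w_ge0 w Q -> f = 0.

Section Existence.
Hypotheses (C_brown : brown_representability C) (w_smash : smashing w).

(** Every object has a coreflection in [w_ge0 w]. *)
Lemma positive_coreflection (M : C) :
  exists (L : C) (i : hom L M), w_ge0 w L /\
    forall (Q : C) (a : hom Q M), w_ge0 w Q -> exists! f : hom Q L, i \oc f = a.
Proof.
pose N : presheaf (positive w) := restriction (w_ge0 w) (representable_presheaf M).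
have N_add : additive_presheaf N.
  by move=> X Y f g y; exact: pcompDr.
have [||[L Lge] [i iU]] := @positive_representable C w C_brown w_smash N N_add.
- move=> P Q D f g h fgh y yf0.
  by have [z ->] := dist_extend fgh yf0; exists z.
- by move=> I Q S inj Scop y; exact: Scop.
by exists L, i; split=> // Q a Qge; exact: (iU (exist _ Q Qge)).
Qed.

Lemma dist_of_third (L Q : C) (h : hom Q (T L)) :
  exists (E : C) (a : hom L E) (b : hom E Q), dist a b h.
Proof.
have [E [b [d bhd]]] := dist_fiber h; have [a aE] := shift_full (- d).
by exists E, a, b; apply/dist_rotate; rewrite aE opprK.
Qed.

(** The cone of the coreflection is right orthogonal to the class. *)
Lemma positive_truncation (M : C) :
  exists (L R : C) (i : hom L M) (p : hom M R) (d : hom R (T L)),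
    [/\ w_ge0 w L, right_orth R & dist i p d].
Proof.
have [L [i [Lge iU]]] := positive_coreflection M.
have [R [p [d ipd]]] := dist_cone i; exists L, R, i, p, d; split=> // Q y Qge.
(* [E] is the extension of [Q] by [L] classified by [d \oc y]. As it lies in
   [w_ge0], the coreflection property splits it. *)
have [E [a [b abh]]] := dist_of_third (d \oc y).
have Ege := ge0_extension abh Lge Qge.
have dy0 : d \oc y = 0.
  have [|c cE] := dist_extend4 abh (x := fmap T i).
    by rewrite comp_assoc (dist_comp0_shift ipd) comp0l.
  have [c0 c0E] := shift_full c; move: cE; rewrite -c0E -fmap_comp => /shift_inj iE.
  have [f [fE _]] := iU _ c0 Ege.
  have fa : f \oc a = idc L.
    have [g [_ gU]] := iU _ i Lge.
    by rewrite -(gU (idc L)) ?comp_idr // (gU (f \oc a)) // comp_assoc fE -iE.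
  rewrite -[d \oc y]comp_idl -fmap_id -fa fmap_comp -comp_assoc.
  by rewrite (dist_comp0_shift abh) comp0r.
have [y' ->] := dist_lift3 ipd dy0; have [f [<- _]] := iU _ y' Qge.
by rewrite comp_assoc (dist_comp0 ipd) comp0l.
Qed.

Lemma adjacent_t_structure : exists t : t_structure C, right_adjacent t w.
Proof.
(* An object lies in the desuspension of [ge] iff it is right orthogonal to
   [w_ge0]. *)
pose ge (X : C) : Prop := forall (Q : C) (f : hom (T Q) X), w_ge0 w Q -> f = 0.
have ge_iso : closed_under_iso ge.
  move=> X Y [e [e' [e'e ee']]] Xge Q f Qge.
  by rewrite -[f]comp_idl -ee' -comp_assoc (Xge Q (e' \oc f)) ?comp0r.
have le_iso : closed_under_iso (w_ge0 w) by move=> X Y; exact: ge0_iso.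
have ge_shift X : ge X -> shifted ge X.
  move=> Xge; have [Y [e [e' [e'e ee']]]] := desuspension X.
  exists Y; split; last by exists e', e.
  move=> Q f Qge; apply: shift_inj.
  rewrite shift0 -[fmap _ f]comp_idl -e'e -comp_assoc.
  by rewrite (Xge _ (e \oc _)) ?comp0r //; exact: ge0_shift.
have orth X Y : w_ge0 w X -> unshifted ge Y -> forall f : hom X Y, f = 0.
  move=> Xge [Y' [Y'ge [e [e' [e'e ee']]]]] f; apply: shift_inj.
  rewrite shift0 -[fmap _ f]comp_idl -e'e -comp_assoc.
  by rewrite (Y'ge _ (e \oc _)) ?comp0r.
have dec (M : C) : exists (L R : C) (i : hom L M) (p : hom M R) (d : hom R (T L)),
    [/\ w_ge0 w L, unshifted ge R & dist i p d].
  have [L [R [i [p [d [Lge Ro ipd]]]]]] := positive_truncation M.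
  exists L, R, i, p, d; split=> //; exists (T R); split.
    move=> Q f Qge; have [f0 <-] := shift_full f.
    by rewrite (Ro _ f0) ?shift0.
  by exists (idc _); exact: id_is_iso.
by exists (TStructure le_iso ge_iso (@w_ge0_shift _ w) ge_shift orth dec).
Qed.

End Existence.

Section Adjacent.
Variable t : t_structure C.
Hypothesis t_adj : right_adjacent t w.

Lemma unshifted_t_ge0_right_orth (R : C) :
  unshifted (t_ge0 t) R -> right_orth R.
Proof. by move=> Rge Q f /t_adj Qle; exact: t_orthogonal Qle Rge f. Qed.

(** Morphisms to right orthogonal objects detect the class [w_ge0 w]. *)
Lemma ge0_of_orthogonal (X : C) :
  (forall (R : C) (f : hom X R), right_orth R -> f = 0) -> w_ge0 w X.
Proof.
move=> Xo.
have [L [R [i [p [d [/t_adj Lge /unshifted_t_ge0_right_orth Ro ipd]]]]]] :=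
  t_decomposition t X.
have [|y yE] := dist_lift ipd (x := idc X); first by rewrite comp_idr; exact: Xo.
by apply: (w_ge0_retracts _ Lge); exists y, i.
Qed.

Lemma adjacent_smashing : has_coproducts C -> smashing w.
Proof.
move=> Ccop; split=> // I X S inj Scop Xge; apply: ge0_of_orthogonal => R f Ro.
by apply: (coproduct_ext Scop) => i; rewrite comp0l; apply: Ro.
Qed.

Lemma right_orth_unshifted_t_ge0 (X : C) :
  right_orth X -> unshifted (t_ge0 t) X.
Proof.
move=> Xo.
have [L [R [i [p [d [/t_adj Lge Rge ipd]]]]]] := t_decomposition t X.
have Ro := unshifted_t_ge0_right_orth Rge.
(* As [i = 0], the map [R -> L[1]] has a section, which is zero; so [L[1]] is
   zero and [p] is an isomorphism. *)
have i0 : i = 0 by exact: Xo.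
have [|s sE] := dist_lift4 ipd (x := idc _); first by rewrite i0 shift0 comp0l.
have TL0 : idc (T L) = 0.
  by rewrite sE (Ro _ s) ?comp0r //; exact: ge0_shift.
have [y yE] : exists y, idc X = y \oc p.
  by apply: (dist_extend ipd); rewrite i0 comp0r.
have [z zE] : exists z, idc R = p \oc z.
  by apply: (dist_lift3 ipd); rewrite -[d]comp_idl TL0 !comp0l.
have [R' [R'ge RR']] := Rge; exists R'; split=> //; apply: iso_trans RR'.
apply: fmap_iso; exists p, y; split=> //.
by rewrite -[y]comp_idr zE (comp_assoc y) -yE comp_idl.
Qed.

Lemma t_ge0_orthogonal (X : C) :
  t_ge0 t X <-> forall (Q : C) (f : hom (T Q) X), w_ge0 w Q -> f = 0.
Proof.
have [Y TYX] := desuspension X; have [e [e' [e'e ee']]] := TYX.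
split=> [Xge Q f Qge|Xo].
  have Yo : right_orth Y by apply: unshifted_t_ge0_right_orth; exists X.
  have [f0 f0E] := shift_full (e' \oc f).
  rewrite -[f]comp_idl -ee' -comp_assoc -f0E.
  by rewrite (Yo _ f0) // shift0 comp0r.
have Yo : right_orth Y.
  move=> Q f Qge; apply: shift_inj; rewrite shift0 -[fmap _ f]comp_idl -e'e.
  by rewrite -comp_assoc (Xo _ (e \oc _)) ?comp0r.
have [Y' [Y'ge TYY']] := right_orth_unshifted_t_ge0 Yo.
exact: t_ge0_iso (iso_trans (iso_sym TYY') TYX) Y'ge.
Qed.

End Adjacent.
End TStructure.

(** * The heart of the adjacent t-structure *)

Section Covers.
Variables (C : triangulated) (w : weight_structure C) (t : t_structure C).
Local Notation T := (shift C).
Hypotheses (t_adj : right_adjacent t w) (w_smash : smashing w).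

Lemma heart_coproduct (I : small) (X : I -> C) (S : C)
    (inj : forall i, hom (X i) S) :
  is_coproduct inj -> (forall i, in_heart w (X i)) -> in_heart w S.
Proof.
move=> Scop Xh; split.
  apply/le0_orthogonal => Q f Qge; apply: (coproduct_ext Scop) => i.
  by rewrite comp0l (weight_orthogonal (f \oc inj i) (Xh i).1 Qge).
by apply: (w_smash.2 _ _ _ _ Scop) => i; case: (Xh i).
Qed.

(** A coproduct in the heart of [w] is a coproduct in [C]. *)
Lemma coproduct_of_heart (I : small) (X : I -> w_heart w) (S : w_heart w)
    (inj : forall i, hom (X i) S) :
  is_coproduct inj ->
  @is_coproduct C I (fun i => sval (X i)) (sval S) inj.
Proof.
move=> Scop; have [S' [inj' S'cop]] := w_smash.1 I (fun i => sval (X i)).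
have S'h := heart_coproduct S'cop (fun i => svalP (X i)).
pose SH : w_heart w := exist _ S' S'h.
have [|f [g [gf fg fi]]] := @coproduct_iso _ _ _ _ SH inj inj' Scop.
  by move=> Y h; exact: S'cop.
have gi i : @comp C _ _ _ g (inj' i) = inj i.
  rewrite -(fi i); transitivity (@comp (w_heart w) _ _ _ (g \oc f) (inj i)).
    exact: (@comp_assoc (w_heart w)).
  by rewrite gf comp_idl.
move=> Y h; have [h' [h'E h'U]] := S'cop Y h.
exists (@comp C _ _ _ h' f); split=> [i|k kE].
  by rewrite -comp_assoc [X in _ \oc X](fi i).
rewrite (h'U (@comp C _ _ _ k g)) => [|i]; last by rewrite -comp_assoc gi.
by rewrite -comp_assoc [X in _ \oc X]gf comp_idr.
Qed.

(** Given triangles [U i -> A i -> V i] in [w_ge0] and a jointly epimorphic family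
    [V i -> V'], the fiber of the induced map from the coproduct of the [A i] to
    [V'] lies in [w_ge0]. *)
Lemma cover_coproduct (I : small) (V : I -> C) (V' : C)
    (c : forall i, hom (V i) V')
    (U A : I -> C) (k : forall i, hom (U i) (A i)) (v : forall i, hom (A i) (V i))
    (d : forall i, hom (V i) (T (U i)))
    (A' : C) (j : forall i, hom (A i) A') (v' : hom A' V') :
  (forall (X : C) (x : hom V' X), (forall i, x \oc c i = 0) -> x = 0) ->
  (forall i, w_ge0 w (U i)) -> (forall i, w_ge0 w (A i)) ->
  (forall i, dist (k i) (v i) (d i)) ->
  is_coproduct j -> (forall i, v' \oc j i = c i \oc v i) ->
  exists (U' : C) (k' : hom U' A') (d' : hom V' (T U')),
    w_ge0 w U' /\ dist k' v' d'.
Proof.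
move=> cepi Uge Age kvd Acop vE; have [U' [k' [d' kvd']]] := dist_fiber v'.
exists U', k', d'; split=> //; apply: (ge0_of_orthogonal t_adj) => R f Ro.
have orth0 (Q : C) (x : hom (T Q) (T R)) : w_ge0 w Q -> x = 0.
  by move=> Qge; have [x0 <-] := shift_full x; rewrite (Ro _ x0) ?shift0.
have fd0 : fmap T f \oc d' = 0.
  apply: cepi => i.
  have [|y ->] := dist_extend3 (kvd i) (x := fmap T f \oc d' \oc c i).
    rewrite -comp_assoc -vE -comp_assoc (comp_assoc d').
    by rewrite (dist_comp0 (dist_rot kvd')) comp0l comp0r.
  by rewrite (orth0 _ y) ?comp0l.
have [y fE] := dist_extend4 kvd' fd0.
have A'ge : w_ge0 w A' by exact: (w_smash.2 _ _ _ _ Acop).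
by apply: shift_inj; rewrite fE (orth0 _ y A'ge) comp0l shift0.
Qed.

(** Morphisms from [w_le0] lift along a coproduct [v'] of heart covers, and those
    killed by [v'] factor through a coproduct [e'] of maps [e i] between heart
    objects with [v i \oc e i = 0]. *)
Lemma presentation_coproduct (I : small) (Q V A : I -> C)
    (k : forall i, hom (V i) (A i)) (v : forall i, hom (A i) (Q i))
    (d : forall i, hom (Q i) (T (V i)))
    (S A' : C) (inj : forall i, hom (Q i) S) (j : forall i, hom (A i) A')
    (v' : hom A' S) :
  (forall i, w_ge0 w (V i)) -> (forall i, w_ge0 w (A i)) ->
  (forall i, dist (k i) (v i) (d i)) ->
  is_coproduct inj -> is_coproduct j -> (forall i, v' \oc j i = inj i \oc v i) ->
  (forall (B : C) (b : hom B S), w_le0 w B -> exists b', b = v' \oc b') /\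
  exists (B : I -> C) (e : forall i, hom (B i) (A i)) (B' : C)
      (l : forall i, hom (B i) B') (e' : hom B' A'),
    [/\ forall i, in_heart w (B i), is_coproduct l,
        forall i, v i \oc e i = 0, forall i, e' \oc l i = j i \oc e i &
        forall (D : C) (u : hom D A'), w_le0 w D -> v' \oc u = 0 ->
          exists u', u = e' \oc u'].
Proof.
move=> Vge Age kvd Scop Acop vE.
have inj_epi (X : C) (x : hom S X) : (forall i, x \oc inj i = 0) -> x = 0.
  by move=> x0; apply: (coproduct_ext Scop) => i; rewrite x0 comp0l.
have [V' [k' [d' [V'ge kvd']]]] := cover_coproduct inj_epi Vge Age kvd Acop vE.
split=> [B b Ble|]; first exact: (heart_cover_lift V'ge kvd').
have ci i : exists c : hom (V i) V',
    fmap T c \oc d i = d' \oc inj i /\ k' \oc c = j i \oc k i.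
  have [c1 [c1d c1k]] :=
    dist_morphism (dist_rot (kvd i)) (dist_rot kvd') (esym (vE i)).
  have [c cE] := shift_full c1; exists c; rewrite cE; split=> //.
  apply: shift_inj; rewrite !fmap_comp cE; apply: oppr_inj.
  by rewrite -compNl -compNr.
pose c i := sval (cid (ci i)).
have cd i : fmap T (c i) \oc d i = d' \oc inj i by case: (svalP (cid (ci i))).
have ck i : k' \oc c i = j i \oc k i by case: (svalP (cid (ci i))).
have cepi (X : C) (x : hom V' X) : (forall i, x \oc c i = 0) -> x = 0.
  move=> xc0; apply: shift_inj; rewrite shift0.
  apply: (cone_coproduct_epi Acop Scop (fun i => dist_rot (kvd i)) (dist_rot kvd')
    (c := fun i => fmap T (c i))) => // i.
    by rewrite compNl compNr -!fmap_comp ck.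
  by rewrite -fmap_comp xc0 shift0.
have covi i : exists p : {B : C & hom B (V i)}, in_heart w (tag p) /\
    exists (U : C) (a : hom U (tag p)) (b : hom (V i) (T U)),
      w_ge0 w U /\ dist a (tagged p) b.
  have [B [U [a [q [b [Bh Uge abq]]]]]] := heart_cover (Vge i).
  by exists (existT _ B q); split=> //; exists U, a, b.
pose B i := tag (sval (cid (covi i))).
pose q i : hom (B i) (V i) := tagged (sval (cid (covi i))).
have Bh i : in_heart w (B i) by case: (svalP (cid (covi i))).
have qdist i : exists U, exists (a : hom U (B i)) (b : hom (V i) (T U)),
    w_ge0 w U /\ dist a (q i) b by case: (svalP (cid (covi i))).
pose U i := sval (cid (qdist i)).
have adist i : exists ab : hom (U i) (B i) * hom (V i) (T (U i)),
    w_ge0 w (U i) /\ dist ab.1 (q i) ab.2.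
  by have [a [b ab]] := svalP (cid (qdist i)); exists (a, b).
have [B' [l Bcop]] := w_smash.1 I B.
have [q' q'E] := coproduct_map (fun i => c i \oc q i) Bcop.
have [U' [a' [b' [U'ge ab']]]] := cover_coproduct cepi
  (fun i => (svalP (cid (adist i))).1) (fun i => (Bh i).2)
  (fun i => (svalP (cid (adist i))).2) Bcop q'E.
exists B, (fun i => k i \oc q i), B', l, (k' \oc q'); split=> // [i|i|D u Dle vu0].
- by rewrite comp_assoc (dist_comp0 (kvd i)) comp0l.
- by rewrite -comp_assoc q'E !comp_assoc ck.
have [u1 ->] := dist_lift kvd' vu0.
have [u2 ->] := heart_cover_lift U'ge ab' u1 Dle.
by exists u2; rewrite comp_assoc.
Qed.

End Covers.

Section HeartExtension.
Variables (C : triangulated) (w : weight_structure C) (t : t_structure C).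
Local Notation T := (shift C).
Local Notation W := (positive w).
Local Notation H := (w_heart w).
Hypotheses (t_adj : right_adjacent t w) (w_smash : smashing w).
Variable G : presheaf H.
Hypotheses (G_add : additive_presheaf G) (G_prod : respects_products G).

(** The action of [G] on a morphism of [C] between objects of the heart. *)
Definition hpb (A B : H) (f : @hom C (sval A) (sval B)) :
  {additive sections G B -> sections G A} := @pullback H G A B f.

Lemma hpb_id (A : H) (x : sections G A) : hpb (idc (sval A)) x = x.
Proof. exact: (@pullback_id H G A x). Qed.

Lemma hpb_comp (A B D : H) (g : @hom C (sval B) (sval D))
    (f : @hom C (sval A) (sval B)) (x : sections G D) :
  hpb (g \oc f) x = hpb f (hpb g x).
Proof. exact: (@pullback_comp H G A B D g f x). Qed.

Lemma hpbD (A B : H) (f g : @hom C (sval A) (sval B)) (x : sections G B) :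
  hpb (f + g) x = hpb f x + hpb g x.
Proof. exact: G_add. Qed.

Lemma hpbB (A B : H) (f g : @hom C (sval A) (sval B)) (x : sections G B) :
  hpb (f - g) x = hpb f x - hpb g x.
Proof. exact: (@pullbackB H G G_add A B f g x). Qed.

Lemma hpb0 (A B : H) (x : sections G B) :
  hpb (0 : @hom C (sval A) (sval B)) x = 0.
Proof. exact: (@pullback0 H G G_add A B x). Qed.

Lemma cover_ex (Q : W) : exists p : {A : H & @hom C (sval A) (sval Q)},
  exists (V : C) (k : hom V (sval (tag p))) (d : hom (sval Q) (T V)),
    w_ge0 w V /\ dist k (tagged p) d.
Proof.
have [A [V [k [v [d [Ah Vge kvd]]]]]] := heart_cover (svalP Q).
by exists (existT _ (exist _ A Ah : H) v); exists V, k, d.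
Qed.

(** A chosen heart cover [cover_map Q : cover_obj Q -> Q], and chosen lifts
    along it. *)
Definition cover_obj (Q : W) : H := tag (sval (cid (cover_ex Q))).
Definition cover_map (Q : W) : @hom C (sval (cover_obj Q)) (sval Q) :=
  tagged (sval (cid (cover_ex Q))).

Lemma cover_dist (Q : W) :
  exists (V : C) (k : hom V (sval (cover_obj Q))) (d : hom (sval Q) (T V)),
    w_ge0 w V /\ dist k (cover_map Q) d.
Proof. exact: (svalP (cid (cover_ex Q))). Qed.

Lemma cover_mapP (Q : W) (B : H) (b : @hom C (sval B) (sval Q)) :
  exists b' : @hom C (sval B) (sval (cover_obj Q)), cover_map Q \oc b' = b.
Proof.
have [V [k [d [Vge kvd]]]] := cover_dist Q.
by have [b' ->] := heart_cover_lift Vge kvd b (svalP B).1; exists b'.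
Qed.

Definition cover_lift (Q : W) (B : H) (b : @hom C (sval B) (sval Q)) :
  @hom C (sval B) (sval (cover_obj Q)) := sval (cid (cover_mapP b)).

Lemma cover_liftK (Q : W) (B : H) (b : @hom C (sval B) (sval Q)) :
  cover_map Q \oc cover_lift b = b.
Proof. by rewrite /cover_lift; case: (cid _). Qed.

(** The sections on the heart cover of [Q] that define a natural
    transformation from Hom(-, Q) on the heart to [G]. *)
Definition compatible_mem (Q : W) (x : sections G (cover_obj Q)) : Prop :=
  forall (B : H) (u : @hom C (sval B) (sval (cover_obj Q))),
    cover_map Q \oc u = 0 -> hpb u x = 0.

Lemma compatible0 (Q : W) : @compatible_mem Q 0.
Proof. by move=> B u _; rewrite raddf0. Qed.

Lemma compatibleB (Q : W) (x y : sections G (cover_obj Q)) :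
  compatible_mem x -> compatible_mem y -> compatible_mem (x - y).
Proof. by move=> xc yc B u u0; rewrite raddfB xc ?yc ?subrr. Qed.

Definition compatible (Q : W) : zmod_class (sections G (cover_obj Q)) :=
  @ZmodClass _ (@compatible_mem Q) (@compatible0 Q) (@compatibleB Q).

(** The value at [Q] of the right Kan extension of [G]. *)
Definition kan (Q : W) : zmodType := subgrp (compatible Q).

(** The component at [B] of the natural transformation [x], applied to [b]. *)
Definition ev (Q : W) (B : H) (b : @hom C (sval B) (sval Q)) (x : kan Q) :
  sections G B := hpb (cover_lift b) (subgrp_val x).

Lemma evE (Q : W) (B : H) (b : @hom C (sval B) (sval Q))
    (b' : @hom C (sval B) (sval (cover_obj Q))) (x : kan Q) :
  cover_map Q \oc b' = b -> hpb b' (subgrp_val x) = ev b x.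
Proof.
move=> b'E; apply/eqP; rewrite -subr_eq0 -hpbB; apply/eqP.
by apply: (subgrp_valP x); rewrite compBr b'E cover_liftK subrr.
Qed.

Lemma ev_cover_map (Q : W) (x : kan Q) : ev (cover_map Q) x = subgrp_val x.
Proof. by rewrite -(evE x (comp_idr (cover_map Q))) hpb_id. Qed.

Lemma ev_comp (Q : W) (A B : H) (b : @hom C (sval B) (sval Q))
    (a : @hom C (sval A) (sval B)) (x : kan Q) :
  ev (b \oc a) x = hpb a (ev b x).
Proof.
rewrite -hpb_comp; apply/esym/evE.
by rewrite comp_assoc cover_liftK.
Qed.

Lemma ev_ext (Q : W) (x y : kan Q) :
  (forall (B : H) (b : @hom C (sval B) (sval Q)), ev b x = ev b y) -> x = y.
Proof. by move=> xy; apply: subgrp_val_inj; rewrite -!ev_cover_map; exact: xy. Qed.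

Lemma evDr (Q : W) (B : H) (b : @hom C (sval B) (sval Q)) (x y : kan Q) :
  ev b (x + y) = ev b x + ev b y.
Proof. by rewrite /ev !raddfD. Qed.

Lemma ev0r (Q : W) (B : H) (b : @hom C (sval B) (sval Q)) :
  ev b (0 : kan Q) = 0.
Proof. by rewrite /ev !raddf0. Qed.

Lemma evDl (Q : W) (B : H) (a b : @hom C (sval B) (sval Q)) (x : kan Q) :
  ev (a + b : hom (sval B) (sval Q)) x = ev a x + ev b x.
Proof. by rewrite -hpbD; apply/esym/evE; rewrite compDr !cover_liftK. Qed.

Lemma ev0l (Q : W) (B : H) (x : kan Q) :
  ev (0 : @hom C (sval B) (sval Q)) x = 0.
Proof. by rewrite -(evE x (comp0r _ _)) hpb0. Qed.

(** Every natural family of elements comes from a section of [kan]. *)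
Lemma kan_of_family (Q : W)
    (phi : forall B : H, @hom C (sval B) (sval Q) -> sections G B) :
  (forall (A B : H) (b : @hom C (sval B) (sval Q)) (a : @hom C (sval A) (sval B)),
    phi A (b \oc a) = hpb a (phi B b)) ->
  exists x : kan Q, forall (B : H) (b : @hom C (sval B) (sval Q)), ev b x = phi B b.
Proof.
move=> phiN.
have [x xE] : exists x : kan Q, subgrp_val x = phi (cover_obj Q) (cover_map Q).
  apply: subgrp_sub => B u u0; rewrite -phiN u0.
  by rewrite -(comp0l (sval Q) (0 : @hom C (sval B) (sval B))) phiN hpb0.
by exists x => B b; rewrite /ev xE -phiN cover_liftK.
Qed.

Lemma kan_map_ex (P Q : W) (f : @hom C (sval P) (sval Q)) (x : kan Q) :
  exists y : kan P, forall (B : H) (b : @hom C (sval B) (sval P)),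
    ev b y = ev (f \oc b) x.
Proof.
apply: (kan_of_family (phi := fun B b => ev (f \oc b) x)) => A B b a.
by rewrite comp_assoc ev_comp.
Qed.

Definition kan_map_fun (P Q : W) (f : @hom C (sval P) (sval Q)) (x : kan Q) :
  kan P := sval (cid (kan_map_ex f x)).

Lemma kan_map_funE (P Q : W) (f : @hom C (sval P) (sval Q)) (x : kan Q)
    (B : H) (b : @hom C (sval B) (sval P)) :
  ev b (kan_map_fun f x) = ev (f \oc b) x.
Proof. by rewrite /kan_map_fun; case: (cid _). Qed.

Lemma kan_map_funD (P Q : W) (f : @hom C (sval P) (sval Q)) (x y : kan Q) :
  kan_map_fun f (x + y) = kan_map_fun f x + kan_map_fun f y.
Proof. by apply: ev_ext => B b; rewrite evDr !kan_map_funE evDr. Qed.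

Definition kan_map (P Q : W) (f : @hom C (sval P) (sval Q)) :
  {additive kan Q -> kan P} := mk_additive (kan_map_funD f).

Lemma kan_mapE (P Q : W) (f : @hom C (sval P) (sval Q)) (x : kan Q)
    (B : H) (b : @hom C (sval B) (sval P)) :
  ev b (kan_map f x) = ev (f \oc b) x.
Proof. exact: kan_map_funE. Qed.

Lemma kan_map_id (P : W) (x : kan P) : kan_map (idc (sval P)) x = x.
Proof. by apply: ev_ext => B b; rewrite kan_mapE comp_idl. Qed.

Lemma kan_map_comp (P Q R : W) (g : @hom C (sval Q) (sval R))
    (f : @hom C (sval P) (sval Q)) (x : kan R) :
  kan_map (g \oc f) x = kan_map f (kan_map g x).
Proof. by apply: ev_ext => B b; rewrite !kan_mapE comp_assoc. Qed.

(** The right Kan extension of [G] to [W]. *)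
Definition kan_extension : presheaf W :=
  @mk_presheaf W kan kan_map kan_map_id kan_map_comp.

Lemma kan_extension_additive : additive_presheaf kan_extension.
Proof.
move=> P Q f g x; apply: (@ev_ext P) => B b; rewrite evDr.
rewrite [LHS](@kan_mapE P Q) [X in _ = X + _](@kan_mapE P Q).
rewrite [X in _ = _ + X](@kan_mapE P Q) -evDl; congr ev; exact: compDl.
Qed.

Lemma kan_extension_exact (P Q D : W) (f : @hom C (sval P) (sval Q))
    (g : @hom C (sval Q) (sval D)) (h : hom (sval D) (T (sval P))) :
  dist f g h -> forall y : kan Q, kan_map f y = 0 ->
  exists z : kan D, kan_map g z = y.
Proof.
move=> fgh y fy0.
have wd (B : H) (c c' : @hom C (sval B) (sval Q)) :
    g \oc c = g \oc c' -> ev c y = ev c' y.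
  move=> gc; have [|r rE] := dist_lift fgh (x := c - c').
    by rewrite compBr gc subrr.
  have -> : c = f \oc r + c' by rewrite -rE subrK.
  by rewrite evDl -kan_mapE fy0 ev0r add0r.
have gl (B : H) (b : @hom C (sval B) (sval D)) :
    exists c : @hom C (sval B) (sval Q), g \oc c = b.
  have [|c ->] := dist_lift3 fgh (x := b); last by exists c.
  exact: (weight_orthogonal _ (svalP B).1 (svalP P)).
have gK (B : H) (b : @hom C (sval B) (sval D)) : g \oc sval (cid (gl B b)) = b.
  by case: (cid _).
have [|z zE] := @kan_of_family D (fun B b => ev (sval (cid (gl B b))) y).
  move=> A B b a; rewrite -ev_comp; apply: wd.
  by rewrite comp_assoc !gK.
exists z; apply: ev_ext => B b; rewrite kan_mapE zE; apply: wd.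
by rewrite gK.
Qed.

Lemma heart_coproduct_sections (I : small) (A : I -> H) (S : C)
    (j : forall i, hom (sval (A i)) S) : is_coproduct j ->
  exists Sh : in_heart w S,
    forall x : (forall i, sections G (A i)),
    exists! s : sections G (exist _ S Sh : H),
      forall i, @hpb (A i) (exist _ S Sh) (j i) s = x i.
Proof.
move=> Scop; exists (heart_coproduct w_smash Scop (fun i => svalP (A i))).
by apply: G_prod => Y h; exact: Scop.
Qed.

Lemma kan_extension_products (I : small) (Q : I -> W) (S : W)
    (inj : forall i, @hom C (sval (Q i)) (sval S)) :
  is_coproduct inj -> forall y : (forall i, kan (Q i)),
  exists! s : kan S, forall i, kan_map (inj i) s = y i.
Proof.
move=> Scop y.
have [A' [j Acop]] := w_smash.1 I (fun i => sval (cover_obj (Q i))).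
have [v vE] := coproduct_map (fun i => inj i \oc cover_map (Q i)) Acop.
have [A'h GA] := heart_coproduct_sections Acop.
pose A : H := exist _ A' A'h.
pose V i := sval (cid (cover_dist (Q i))).
have kd i : exists kd :
    hom (V i) (sval (cover_obj (Q i))) * hom (sval (Q i)) (T (V i)),
    w_ge0 w (V i) /\ dist kd.1 (cover_map (Q i)) kd.2.
  by have [k [d kd]] := svalP (cid (cover_dist (Q i))); exists (k, d).
have [vlift [B [e [B' [l [e' [Bh Bcop ve0 e'E e'lift]]]]]]] :=
  presentation_coproduct t_adj w_smash
  (fun i => (svalP (cid (kd i))).1) (fun i => (svalP (cover_obj (Q i))).2)
  (fun i => (svalP (cid (kd i))).2) Scop Acop vE.
have [B'h GB] :=
  @heart_coproduct_sections I (fun i => exist _ (B i) (Bh i)) B' l Bcop.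
have vl (D : H) (b : @hom C (sval D) (sval S)) :
    exists b' : @hom C (sval D) A', v \oc b' = b.
  by have [b' ->] := vlift _ b (svalP D).1; exists b'.
have vK (D : H) (b : @hom C (sval D) (sval S)) : v \oc sval (cid (vl D b)) = b.
  by case: (cid _).
have [al [alE _]] := GA (fun i => ev (cover_map (Q i)) (y i)).
(* Compatibility of [al]: relations factor through the coproduct [B'] of
   objects of the heart, where [al] can be tested on summands. *)
have al0 (D : H) (u : @hom C (sval D) A') : v \oc u = 0 -> @hpb D A u al = 0.
  move=> /(e'lift _ _ (svalP D).1)[u' ->].
  pose BH : H := exist _ B' B'h.
  rewrite (@hpb_comp D BH A e' u' al).
  suff -> : @hpb BH A e' al = 0 by rewrite raddf0.
  have [z [_ zU]] := GB (fun i => 0).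
  rewrite -(zU (@hpb BH A e' al)) => [|i]; first by apply: zU => i; rewrite raddf0.
  rewrite -(@hpb_comp (exist _ (B i) (Bh i)) BH A) e'E.
  rewrite (@hpb_comp (exist _ (B i) (Bh i)) (cover_obj (Q i)) A) alE -ev_comp ve0.
  exact: ev0l.
have alwd (D : H) (u u' : @hom C (sval D) A') : v \oc u = v \oc u' ->
    @hpb D A u al = @hpb D A u' al.
  move=> uu'; apply/eqP; rewrite -subr_eq0 -hpbB; apply/eqP/al0.
  by rewrite compBr uu' subrr.
have [|s sE] := @kan_of_family S (fun D b => @hpb D A (sval (cid (vl D b))) al).
  move=> D E b a; rewrite -hpb_comp; apply: alwd.
  by rewrite comp_assoc !vK.
exists s; split=> [i|s' s'E].
  apply: ev_ext => D b; rewrite kan_mapE sE -[b in RHS]cover_liftK ev_comp -alE.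
  rewrite -(@hpb_comp D (cover_obj (Q i)) A); apply: alwd.
  by rewrite vK comp_assoc vE -comp_assoc cover_liftK.
have vs : @ev S A v s = @ev S A v s'.
  have [z [_ zU]] := GA (fun i => ev (inj i \oc cover_map (Q i)) s).
  rewrite -(zU (@ev S A v s)) => [|i]; last first.
    by rewrite -(@ev_comp S (cover_obj (Q i)) A) vE.
  apply: zU => i; rewrite -(@ev_comp S (cover_obj (Q i)) A) vE -!kan_mapE s'E.
  rewrite -alE kan_mapE sE; apply: alwd.
  by rewrite vK vE.
apply: ev_ext => D b; rewrite -(vK _ b).
by rewrite !(@ev_comp S D A) vs.
Qed.

(** The presheaf [G] is the restriction of the functor represented by an object
    of the heart of [t]. *)
Lemma heart_object (C_brown : brown_representability C) :
  exists L : C, (t_le0 t L /\ t_ge0 t L) /\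
    exists theta : forall B : H, @hom C (sval B) L -> sections G B,
    [/\ forall (B : H) (f g : @hom C (sval B) L),
          theta B (f + g) = theta B f + theta B g,
        forall (A B : H) (f : @hom C (sval B) L) (a : @hom C (sval A) (sval B)),
          theta A (f \oc a) = hpb a (theta B f),
        forall (B : H) (f : @hom C (sval B) L), theta B f = 0 -> f = 0 &
        forall (B : H) (x : sections G B), exists f, theta B f = x].
Proof.
have [L [n nU]] := positive_representable C_brown w_smash
  kan_extension_additive kan_extension_exact kan_extension_products.
have n0 (Q : W) (f : @hom C (sval Q) (sval L)) : kan_map f n = 0 -> f = 0.
  move=> fn0; have [g [_ gU]] := nU Q 0.
  rewrite -(gU f) //; apply: gU.
  exact: (@pb0 _ _ kan_extension kan_extension_additive).
exists (sval L); split; first split.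
- exact/t_adj/(svalP L).
- apply/(t_ge0_orthogonal t_adj) => Q f Qge.
  apply: (n0 (exist _ (T Q) (ge0_shift Qge)) f); apply: ev_ext => B b.
  rewrite kan_mapE ev0r.
  have -> : b = 0 by exact: (weight_orthogonal _ (svalP B).1 Qge).
  by rewrite comp0r ev0l.
exists (fun B f => ev f n); split.
- by move=> B f g; exact: evDl.
- by move=> A B f a; exact: ev_comp.
- move=> B f fn0; apply: (n0 (exist _ (sval B) (svalP B).2) f).
  by apply: ev_ext => D b; rewrite kan_mapE ev0r ev_comp fn0 raddf0.
move=> B x; pose BW : W := exist _ (sval B) (svalP B).2.
have [|z zE] := @kan_of_family BW (fun D b => hpb b x).
  by move=> A D b a; exact: hpb_comp.
have [f [fE _]] := nU BW z; exists f.
rewrite -[RHS]hpb_id -(zE B (idc _)) -fE.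
by rewrite [RHS](@kan_mapE BW L) comp_idr.
Qed.

End HeartExtension.

Section HeartEquivalence.
Variables (C : triangulated) (w : weight_structure C) (t : t_structure C).
Local Notation T := (shift C).
Local Notation H := (w_heart w).
Hypotheses (t_adj : right_adjacent t w) (w_smash : smashing w).

(** The presheaf Hom(-, X) on the heart of [w]. *)
Definition heart_yoneda (X : C) : presheaf H :=
  restriction (in_heart w) (representable_presheaf X).

Lemma heart_yoneda_additive (X : C) : additive_presheaf (heart_yoneda X).
Proof. by move=> A B f g y; exact: pcompDr. Qed.

Lemma heart_yoneda_products (X : C) : respects_products (heart_yoneda X).
Proof.
by move=> I A S inj /(coproduct_of_heart w_smash) Scop y; exact: Scop.
Qed.

Lemma postcompD (X Y B : C) (f : hom X Y) (x y : phom B X) :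
  pcomp f (x + y) = pcomp f x + pcomp f y.
Proof. exact: pcompDr. Qed.

Definition postcomp (X Y B : C) (f : hom X Y) : {additive phom B X -> phom B Y} :=
  mk_additive (@postcompD X Y B f).

Lemma postcomp_natural (X Y : C) (f : hom X Y) (A B : opposite H) (a : hom A B) :
  @comp Ab _ _ _ (@postcomp X Y (sval B) f) (fmap (heart_yoneda X) a) =
  @comp Ab _ _ _ (fmap (heart_yoneda Y) a) (@postcomp X Y (sval A) f).
Proof. by apply: additive_eq => x; exact: pcomp_assoc. Qed.

Definition heart_yoneda_map (X Y : C) (f : hom X Y) :
    nat_trans (heart_yoneda X) (heart_yoneda Y) :=
  @NatTrans (opposite H) Ab (heart_yoneda X) (heart_yoneda Y)
    (fun B => @postcomp X Y (sval B) f) (@postcomp_natural X Y f).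

Lemma heart_yoneda_id (X : C) :
  heart_yoneda_map (idc X) = nt_id (heart_yoneda X).
Proof.
by apply: nat_trans_eq => A; apply: additive_eq => x; exact: pcomp_idl.
Qed.

Lemma heart_yoneda_comp (X Y Z : C) (g : hom Y Z) (f : hom X Y) :
  heart_yoneda_map (g \oc f) = nt_comp (heart_yoneda_map g) (heart_yoneda_map f).
Proof.
apply: nat_trans_eq => A; apply: additive_eq => x.
exact: (esym (pcomp_assoc _ _ _)).
Qed.

(** The comparison functor from the heart of [t] to presheaves on that of [w]. *)
Definition heart_functor : functor (t_heart t) (product_functors H) :=
  @Functor (t_heart t) (product_functors H)
    (fun X => exist _ (heart_yoneda (sval X))
      (conj (@heart_yoneda_additive (sval X)) (@heart_yoneda_products (sval X))))
    (fun X Y f => heart_yoneda_map f)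
    (fun X => heart_yoneda_id (sval X))
    (fun X Y Z g f => heart_yoneda_comp g f).

(** A zero-preserving natural family of maps Hom(B, X) -> Hom(B, Y), for [B] in
    the heart of [w], is composition with a unique morphism X -> Y. *)
Lemma heart_dense (X Y : C) : w_ge0 w X ->
  (forall (Q : C) (f : hom (T Q) Y), w_ge0 w Q -> f = 0) ->
  forall eta : (forall B : H, @hom C (sval B) X -> @hom C (sval B) Y),
  (forall B, eta B 0 = 0) ->
  (forall (A B : H) (b : @hom C (sval B) X) (a : @hom C (sval A) (sval B)),
     eta A (b \oc a) = eta B b \oc a) ->
  exists! f : hom X Y, forall (B : H) (b : @hom C (sval B) X), f \oc b = eta B b.
Proof.
move=> Xge Yo eta eta0 etaN.
have [A [V [k [v [d [Ah Vge kvd]]]]]] := heart_cover Xge.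
pose AH : H := exist _ A Ah.
have lift_v (B : H) (b : @hom C (sval B) X) : exists b', b = v \oc b'.
  exact: (heart_cover_lift Vge kvd b (svalP B).1).
have [|f fE] := dist_extend kvd (x := eta AH v).
  have [B [U [l [q [e [Bh Uge lqe]]]]]] := heart_cover Vge.
  have [|y ->] := dist_extend3 lqe (x := eta AH v \oc k).
    pose BH : H := exist _ B Bh.
    rewrite -comp_assoc -(etaN BH AH v (k \oc q)) comp_assoc (dist_comp0 kvd).
    by rewrite comp0l (eta0 BH).
  by rewrite (Yo _ y) ?comp0l.
exists f; split=> [B b|g gE].
  have [b' ->] := lift_v B b.
  by rewrite comp_assoc -fE -(etaN B AH).
have fgv : (f - g : hom X Y) \oc v = 0.
  by rewrite compBl -fE (gE AH v) subrr.
have [y fgE] := dist_extend3 kvd fgv.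
by apply/eqP; rewrite -subr_eq0 fgE (Yo _ y Vge) comp0l.
Qed.

Lemma heart_functor_ff : fully_faithful heart_functor.
Proof.
move=> X Y g; pose eta (B : H) : {additive phom (sval B) (sval X) ->
  phom (sval B) (sval Y)} := (g : nat_trans _ _) B.
have [X0 Y0] := ((t_adj (sval X)).1 (svalP X).1,
  (t_ge0_orthogonal t_adj (sval Y)).1 (svalP Y).2).
have etaN (A B : H) (b : @hom C (sval B) (sval X))
    (a : @hom C (sval A) (sval B)) : eta A (b \oc a) = @comp C _ _ _ (eta B b) a.
  exact: (congr1 (fun h : {additive phom (sval B) (sval X) ->
    phom (sval A) (sval Y)} => h b) (@nt_natural _ _ _ _ (g : nat_trans _ _) B A a)).
have [f [fE fU]] := heart_dense X0 Y0 (fun B => raddf0 (eta B)) etaN.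
exists f; split=> [|f' f'E].
  apply: nat_trans_eq => B; apply: additive_eq => b; exact: fE.
by apply: fU => B b; rewrite /eta -f'E.
Qed.

Lemma heart_functor_es : brown_representability C ->
  essentially_surjective heart_functor.
Proof.
move=> C_brown [G [G_add G_prod]].
have [L [Lh [theta [thetaD thetaN theta_inj theta_surj]]]] :=
  heart_object t_adj w_smash G_add G_prod C_brown.
pose th (B : H) : {additive phom (sval B) L -> sections G B} :=
  mk_additive (thetaD B).
have th_nat (A B : opposite H) (a : hom A B) :
    @comp Ab _ _ _ (th B) (fmap (heart_yoneda L) a) =
    @comp Ab _ _ _ (fmap G a) (th A).
  by apply: additive_eq => x; exact: thetaN.
exists (exist _ L Lh).
have [B|b ba] := @natural_iso_of_components _ _ (heart_yoneda L) G
    (@NatTrans (opposite H) Ab (heart_yoneda L) G th th_nat).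
  have [|x|u [uth thu]] := @additive_inverse _ _ (th B).
  - apply: raddf_inj => f; exact: theta_inj.
  - exact: theta_surj.
  by exists u; split; apply: additive_eq.
by exists (@NatTrans (opposite H) Ab (heart_yoneda L) G th th_nat), b.
Qed.

Lemma heart_equivalence : brown_representability C ->
  equivalent (t_heart t) (product_functors H).
Proof.
move=> C_brown; exists heart_functor; apply: ff_es_equivalence.
  exact: heart_functor_ff.
exact: heart_functor_es.
Qed.

End HeartEquivalence.

Theorem theorem0p1 (C : triangulated)
    (C_coproducts : has_coproducts C)
    (C_brown : brown_representability C)
    (w : weight_structure C) :
  ((exists t : t_structure C, right_adjacent t w) <-> smashing w) /\
  (forall t : t_structure C, right_adjacent t w ->
     equivalent (t_heart t) (product_functors (w_heart w))).
Proof.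
split=> [|t t_adj].
  split=> [[t t_adj]|w_smash]; first exact: (adjacent_smashing t_adj).
  exact: adjacent_t_structure.
exact: (heart_equivalence t_adj (adjacent_smashing t_adj C_coproducts)).
Qed.
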